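(* There is an algorithm that, given an $n$-vertex tree of diameter at most $3$ whose vertices are colored with any number $k$ of colors in any ratio $c_1:\dots:c_k$ (positive integers), computes a minimum-cost fair clustering in time $O(n)$.
   Context: All graphs are finite, simple and undirected. For a graph $G=(V,E)$ and a partition $\mathcal{P}$ of $V$, write $\mathcal{P}[u]$ for the set of $\mathcal{P}$ containing $u$. The cost is $$\mathrm{cost}(G,\mathcal{P})=\Big|\Big\{\{u,v\}\in\tbinom{V}{2}\setminus E : \mathcal{P}[u]=\mathcal{P}[v]\Big\}\Big|+\Big|\Big\{\{u,v\}\in E:\mathcal{P}[u]\neq\mathcal{P}[v]\Big\}\Big|.$$ A coloring is a map $c:V\to[k]$; let $V_i=c^{-1}(i)$. A set $S\subseteq V$ is fair if $|S\cap V_i|/|S|=|V_i|/|V|$ for every $i\in[k]$. A fair clustering is a partition of $V$ all of whose sets are fair; it is minimum-cost if no fair clustering has smaller cost. The colors are in ratio $c_1:\dots:c_k$ if there is $t\in\mathbb{N}_{>0}$ with $|V_i|=t\,c_i$ for all $i$. *)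

(* Defs.v *)
From mathcomp Require Import all_boot all_order all_algebra.
Set Implicit Arguments. Unset Strict Implicit. Unset Printing Implicit Defensive.
Import GRing.Theory Num.Theory.

Definition simple_graph (n : nat) (e : rel 'I_n) : Prop :=
  symmetric e /\ irreflexive e.

Definition walk_le (n : nat) (e : rel 'I_n) (d : nat) (u v : 'I_n) : Prop :=
  exists s : seq 'I_n, size s <= d /\ path e u s /\ last u s = v.

Definition connected_graph (n : nat) (e : rel 'I_n) : Prop :=
  forall u v : 'I_n, exists s : seq 'I_n, path e u s /\ last u s = v.

Definition acyclic_graph (n : nat) (e : rel 'I_n) : Prop :=
  forall (x : 'I_n) (s : seq 'I_n),
    ~ [/\ uniq (x :: s), 2 <= size s, path e x s & e (last x s) x].

Definition is_tree (n : nat) (e : rel 'I_n) : Prop :=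
  0 < n /\ connected_graph e /\ acyclic_graph e.

Definition diameter_le (n : nat) (e : rel 'I_n) (d : nat) : Prop :=
  forall u v : 'I_n, walk_le e d u v.

Definition color_class (n k : nat) (c : 'I_n -> 'I_k) (i : 'I_k) : {set 'I_n} :=
  [set v | c v == i].

Definition has_color_ratio (n k : nat) (c : 'I_n -> 'I_k) : Prop :=
  exists (cs : 'I_k -> nat) (t : nat),
    [/\ 0 < t, forall i, 0 < cs i & forall i, #|color_class c i| = t * cs i].

Definition fair_set (n k : nat) (c : 'I_n -> 'I_k) (S : {set 'I_n}) : Prop :=
  forall i : 'I_k,
    ((#|S :&: color_class c i|%:R / #|S|%:R)%R : rat)
    = (#|color_class c i|%:R / #|[set: 'I_n]|%:R)%R.

Definition fair_clustering (n k : nat) (c : 'I_n -> 'I_k)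
    (P : {set {set 'I_n}}) : Prop :=
  partition P [set: 'I_n] /\ forall S, S \in P -> fair_set c S.

Definition same_cluster (n : nat) (P : {set {set 'I_n}}) (u v : 'I_n) : bool :=
  pblock P u == pblock P v.

Definition cost (n : nat) (e : rel 'I_n) (P : {set {set 'I_n}}) : nat :=
  #|[set uv : 'I_n * 'I_n | (uv.1 < uv.2) &&
      ((~~ e uv.1 uv.2 && same_cluster P uv.1 uv.2)
       || (e uv.1 uv.2 && ~~ same_cluster P uv.1 uv.2))]|.

Definition min_cost_fair_clustering (n k : nat) (e : rel 'I_n)
    (c : 'I_n -> 'I_k) (P : {set {set 'I_n}}) : Prop :=
  fair_clustering c P /\
  forall Q, fair_clustering c Q -> cost e P <= cost e Q.

(* Model of computation: unit-cost RAM with natural-number registers, *)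
(* indirect addressing, addition and truncated subtraction.           *)

Inductive instr : Type :=
| Const (r c : nat)
| Add (r a b : nat)
| Sub (r a b : nat)
| LoadInd (r a : nat)
| StoreInd (a r : nat)
| Jz (r l : nat)
| Halt.

Definition memory := nat -> nat.

Definition upd (m : memory) (a x : nat) : memory :=
  fun b => if b == a then x else m b.

(* one step; None if the machine has halted (Halt or pc out of range) *)
Definition step (prog : seq instr) (pc : nat) (m : memory)
    : option (nat * memory) :=
  match nth Halt prog pc with
  | Const r c => Some (pc.+1, upd m r c)
  | Add r a b => Some (pc.+1, upd m r (m a + m b))
  | Sub r a b => Some (pc.+1, upd m r (m a - m b))
  | LoadInd r a => Some (pc.+1, upd m r (m (m a)))
  | StoreInd a r => Some (pc.+1, upd m (m a) (m r))
  | Jz r l => Some (if m r == 0 then l else pc.+1, m)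
  | Halt => None
  end.

Fixpoint exec (prog : seq instr) (fuel pc : nat) (m : memory)
    : option memory :=
  match step prog pc m with
  | None => Some m
  | Some (pc', m') =>
      match fuel with
      | 0 => None
      | fuel'.+1 => exec prog fuel' pc' m'
      end
  end.

Definition edge_list (n : nat) (e : rel 'I_n) (L : seq (nat * nat)) : Prop :=
  (forall u v : 'I_n, e u v ->
     count (fun p => (p == (val u, val v)) || (p == (val v, val u))) L = 1)
  /\ (forall p, p \in L -> exists u v : 'I_n, e u v /\ p = (val u, val v)).

(* input layout: M[0] = n, M[1] = k, M[2+v] = color of v (v < n),
   M[2+n+2j], M[3+n+2j] = endpoints of the j-th edge of L; 0 elsewhere *)
Definition input_mem (n k : nat) (c : 'I_n -> 'I_k) (L : seq (nat * nat))
    : memory :=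
  fun a =>
    if a == 0 then n
    else if a == 1 then k
    else if a < 2 + n then
      (if @insub nat (fun x => x < n) 'I_n (a - 2) is Some v then val (c v) else 0)
    else if a < 2 + n + 2 * size L then
      (let j := (a - 2 - n) %/ 2 in
       if odd (a - 2 - n) then (nth (0, 0) L j).2 else (nth (0, 0) L j).1)
    else 0.

Definition output_partition (n : nat) (m : memory) : {set {set 'I_n}} :=
  preim_partition (fun v : 'I_n => m (val v)) [set: 'I_n].

(* Main.v *)
Require Import Defs.
From mathcomp Require Import all_boot all_order all_algebra.
From mathcomp Require Import zify.
From Stdlib Require PeanoNat.
Set Implicit Arguments. Unset Strict Implicit. Unset Printing Implicit Defensive.

(** In a tree of diameter at most 3 some edge [uv] dominates: every other vertex is a leaf of [u] or of
    [v].  Let [g] be the gcd of the colour multiplicities and [d = n / g]; fair sets are exactly the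
    sets having [m] times each reduced multiplicity, so their sizes are multiples of [d].  Counting
    pairs, twice the cost of a clustering is the sum over the vertices of the sizes of their clusters,
    minus four times the number of edges inside clusters, plus a constant.

    If [d > 1], comparing a cluster of size [m d] with one of size [d] shows that clusters of size [d]
    suffice, and one of two clusterings is optimal: either [u] and [v] are clustered together, which
    makes [d - 1] edges internal, or [u] and [v] get as many of their own leaves as the colours permit.
    Both arise by listing the vertices in a suitable order ([u], [v], the leaves, respectively [u],
    leaves of [u], leaves of [v], [v]) and cutting the list of each colour into [g] equal blocks; the
    algorithm computes both and keeps the one with more internal edges.  If [d = 1] there is a single
    colour and matching [u] and [v] with leaves is optimal.

    The dominating edge is found as the one whose degrees sum to [n], and [g] by Euclid's algorithm with
    subtractions, whose total number of steps is linear because the multiplicities sum to [n]. *)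

(** * Running straight-line code and loops on the RAM *)

(** Why clusters larger than [d] do not pay: passing from size [d] to size [m d] adds
    [m d (m - 1) d] to the sum of the cluster sizes and allows at most [(m - 1) d] more internal
    edges, each worth 4. The loss covers the gain because [m d >= 4] when [m, d >= 2]. This breaks
    down for [d = 1], where a pair joined by an edge is better than two singletons; hence the
    separate case.

    Joining [u] and [v] in a cluster of size [d] is impossible when they share a colour of reduced
    multiplicity 1. A fair clustering that joins them then needs a cluster of size at least [2 d],
    and is no cheaper than the other candidate, which still keeps at least one edge.

    The machine has neither multiplication nor division, so block numbers are maintained
    incrementally. All phases are straight-line pieces or unnested loops of [n] rounds, so linear
    time can be read off the syntax. *)

Lemma upd_eq m a x b : b = a -> upd m a x b = x.
Proof. by rewrite /upd => ->; rewrite eqxx. Qed.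

Lemma upd_neq m a x b : b <> a -> upd m a x b = m b.
Proof. by rewrite /upd => /eqP /negPf ->. Qed.

(* Stated for every remaining fuel, so that runs compose by adding their lengths. *)
Definition reach prog T pc m pc' m' :=
  forall f, exec prog (T + f) pc m = exec prog f pc' m'.

Lemma reach_step prog pc m pc' m' :
  step prog pc m = Some (pc', m') -> reach prog 1 pc m pc' m'.
Proof. by move=> h f /=; rewrite h. Qed.

Lemma reach_trans prog T1 T2 p1 m1 p2 m2 p3 m3 :
  reach prog T1 p1 m1 p2 m2 -> reach prog T2 p2 m2 p3 m3 ->
  reach prog (T1 + T2) p1 m1 p3 m3.
Proof. by move=> h1 h2 f; rewrite -addnA h1 h2. Qed.

Definition code_at (prog : seq instr) p (code : seq instr) :=
  forall i, i < size code -> nth Halt prog (p + i) = nth Halt code i.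

Lemma code_at_cat prog p c1 c2 :
  code_at prog p (c1 ++ c2) ->
  code_at prog p c1 /\ code_at prog (p + size c1) c2.
Proof.
move=> h; split=> i hi.
  by rewrite h ?nth_cat ?hi // size_cat ltn_addr.
rewrite -addnA h ?size_cat ?ltn_add2l // nth_cat.
by rewrite ltnNge leq_addr /= addKn.
Qed.

Lemma code_at_head prog p i c :
  code_at prog p (i :: c) -> nth Halt prog p = i /\ code_at prog p.+1 c.
Proof.
move=> h; split; first by rewrite -[p]addn0 h.
by move=> j hj; rewrite addSnnS h.
Qed.

Definition basic i := match i with Jz _ _ | Halt => false | _ => true end.

Definition effect m i := match i with
  | Const r c => upd m r c
  | Add r a b => upd m r (m a + m b)
  | Defs.Sub r a b => upd m r (m a - m b)
  | LoadInd r a => upd m r (m (m a))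
  | StoreInd a r => upd m (m a) (m r)
  | _ => m
  end.

Lemma reach_basic prog p code m :
  code_at prog p code -> all basic code ->
  reach prog (size code) p m (p + size code) (foldl effect m code).
Proof.
elim: code p m => [|i code IH] p m; first by rewrite addn0.
move=> /code_at_head[hi hc] /= /andP[bi bc].
rewrite -add1n addnA addn1.
apply: reach_trans (IH _ _ hc bc).
by apply: reach_step; rewrite /step hi; case: i bi {hi}.
Qed.

Lemma reach_jz prog p r l m :
  nth Halt prog p = Jz r l ->
  reach prog 1 p m (if m r == 0 then l else p.+1) m.
Proof. by move=> h; apply: reach_step; rewrite /step h. Qed.

(** The truncated difference [rb - rc] is zero exactly when the counter has reached the bound. There
    is no unconditional jump, so [Const rt 0; Jz rt] serves as one. *)
Definition for_code rb rc rt p (body : seq instr) :=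
  [:: Const rc 0; Defs.Sub rt rb rc; Jz rt (p + size body + 7)] ++ body ++
  [:: Const rt 1; Add rc rc rt; Const rt 0; Jz rt p.+1].

Lemma size_for_code rb rc rt p body : size (for_code rb rc rt p body) = size body + 7.
Proof. by rewrite /for_code /= size_cat /=; lia. Qed.

(** A round costs 2 steps for the test, at most [Tb] for the body and 4 for the increment and the
    jump; the extra 3 are the initialisation and the last, failing test. The invariant must ignore
    [rt], which the loop overwrites at will. *)
Lemma for_reach prog p rb rc rt body N Tb (I : nat -> memory -> Prop) m :
  code_at prog p (for_code rb rc rt p body) ->
  uniq [:: rb; rc; rt] ->
  (forall j m, I j m -> m rb = N /\ m rc = j) ->
  (forall j m x, I j m -> I j (upd m rt x)) ->
  (forall j m, j < N -> I j m -> exists T m',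
     [/\ T <= Tb, reach prog T (p + 3) m (p + 3 + size body) m',
         m' rc = j & forall x y, I j.+1 (upd (upd (upd m' rt x) rc j.+1) rt y)]) ->
  I 0 (upd m rc 0) ->
  exists T m', [/\ T <= 3 + N * (Tb + 6),
     reach prog T p m (p + (size body + 7)) m' & I N m'].
Proof.
move=> hat huniq hI ht hb h0.
have [hrb hrc] : rc <> rt /\ rb <> rt.
  by move: huniq => /=; rewrite !inE; case: eqP; case: eqP; case: eqP.
move: hat; rewrite /for_code => /code_at_cat[hh /code_at_cat[hbody ht2]].
move: hh => /code_at_head[i1 /code_at_head[i2 /code_at_head[i3 _]]].
rewrite /= addn3 in hbody ht2.
have main d j mj : N = j + d -> I j mj -> exists T m',
    [/\ T <= 2 + d * (Tb + 6), reach prog T p.+1 mj (p + (size body + 7)) m' & I N m'].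
  elim: d j mj => [|d IH] j mj hN hIj.
    have [e1 e2] := hI _ _ hIj.
    exists 2, (upd mj rt (mj rb - mj rc)); split=> //.
      apply: (@reach_trans _ 1 1).
        by apply: reach_step; rewrite /step i2.
      have := @reach_jz _ _ _ _ (upd mj rt (mj rb - mj rc)) i3.
      by rewrite upd_eq // e1 e2 hN addn0 subnn eqxx addnA.
    by rewrite hN addn0; apply: ht.
  have [e1 e2] := hI _ _ hIj.
  have hjN : j < N by lia.
  have [T [m' [hT hr hrc' hI']]] := hb _ _ hjN (@ht _ _ (mj rb - mj rc) hIj).
  have tl := @reach_basic prog _ [:: Const rt 1; Add rc rc rt; Const rt 0] m'.
  have := tl (p.+3 + size body).
  move: (ht2) => /(@code_at_cat _ _ [:: _; _; _])[h3 h1] /(_ h3 erefl) /= hr2.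
  have [i4 _] := code_at_head h1.
  rewrite (_ : upd (upd _ _ _) _ _ = upd (upd (upd m' rt 1) rc j.+1) rt 0) in hr2; last first.
    by rewrite (upd_neq _ _ hrb) hrc' (upd_eq _ _ erefl) addn1.
  have [T' [m'' [hT' hr' hI'']]] := IH j.+1 _ ltac:(lia) (hI' 1 0).
  exists (1 + (1 + (T + (3 + (1 + T'))))), m''; split => //; first by lia.
  apply: reach_trans (reach_step _) _; first by rewrite /step i2.
  apply: reach_trans (reach_jz _ i3) _.
  rewrite upd_eq // (_ : (_ == 0) = false); last by apply/eqP; lia.
  rewrite addn3 in hr.
  apply: reach_trans hr _; apply: reach_trans hr2 _.
  have := @reach_jz _ _ _ _ (upd (upd (upd m' rt 1) rc j.+1) rt 0) i4.
  rewrite upd_eq // eqxx => h; apply: reach_trans h hr'.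
have [T [m' [hT hr hIN]]] := main N 0 _ erefl h0.
exists (1 + T), m'; split=> //.
by apply: reach_trans (reach_step _) hr; rewrite /step i1.
Qed.

(* Scalars live in cells [0..19]; cells 20 and 21 are scratch and cell 22 holds the base [B] of the
   arrays, entry [i] of array [a] being cell [B + 16 * i + a].  Interleaving makes all arrays
   unbounded without any aliasing. *)
Inductive scmd : Type :=
| SConst (x k : nat)
| SAdd (x y z : nat)
| SSub (x y z : nat)
| SLd (x a i : nat)
| SSt (a i x : nat)
| SSeq (s1 s2 : scmd)
| SIf (x : nat) (s1 s2 : scmd)
| SSkip.

Record state := State { sV : nat -> nat; sA : nat -> nat -> nat }.

(** Scalar and array numbers are concrete, so comparing them with [Nat.eqb] lets [/=] evaluate
    lookups; array indices are symbolic and stay behind [upd]. *)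
Definition setV st x v := State (fun y => if Nat.eqb y x then v else sV st y) (sA st).
Definition setA st a i v :=
  State (sV st) (fun b => if Nat.eqb b a then upd (sA st a) i v else sA st b).

Fixpoint den c st := match c with
  | SConst x k => setV st x k
  | SAdd x y z => setV st x (sV st y + sV st z)
  | SSub x y z => setV st x (sV st y - sV st z)
  | SLd x a i => setV st x (sA st a (sV st i))
  | SSt a i x => setA st a (sV st i) (sV st x)
  | SSeq c1 c2 => den c2 (den c1 st)
  | SIf x c1 c2 => if sV st x == 0 then den c2 st else den c1 st
  | SSkip => st
  end.

(** Four doublings replace the missing multiplication by 16. *)
Definition addr_code a i :=
  [:: Add 20 i i; Add 20 20 20; Add 20 20 20; Add 20 20 20; Add 20 20 22;
      Const 21 a; Add 20 20 21].

Fixpoint csize c := match c with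
  | SConst _ _ | SAdd _ _ _ | SSub _ _ _ => 1
  | SLd _ _ _ | SSt _ _ _ => 8
  | SSeq c1 c2 => csize c1 + csize c2
  | SIf _ c1 c2 => csize c1 + csize c2 + 3
  | SSkip => 0
  end.

(** Jump targets are absolute, so the load address [p] is threaded through. The pair
    [Const 21 0; Jz 21] skips the else branch. *)
Fixpoint comp p c := match c with
  | SConst x k => [:: Const x k]
  | SAdd x y z => [:: Add x y z]
  | SSub x y z => [:: Defs.Sub x y z]
  | SLd x a i => addr_code a i ++ [:: LoadInd x 20]
  | SSt a i x => addr_code a i ++ [:: StoreInd 20 x]
  | SSeq c1 c2 => comp p c1 ++ comp (p + csize c1) c2
  | SIf x c1 c2 =>
      [:: Jz x (p + csize c1 + 3)] ++ comp p.+1 c1 ++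
      [:: Const 21 0; Jz 21 (p + (csize c1 + csize c2 + 3))] ++
      comp (p + csize c1 + 3) c2
  | SSkip => [::]
  end.

Lemma size_comp p c : size (comp p c) = csize c.
Proof.
by elim: c p => //= [c1 h1 c2 h2|x c1 h1 c2 h2] p; rewrite !size_cat /= !(h1, h2); lia.
Qed.

(* Cell 0 (the input size) and cell 1 (the loop counter) are read-only for scalar code. *)
Fixpoint wf c := match c with
  | SConst x _ => 1 < x < 20
  | SAdd x y z | SSub x y z => [&& 1 < x < 20, y < 20 & z < 20]
  | SLd x a i => [&& 1 < x < 20, a < 16 & i < 20]
  | SSt a i x => [&& x < 20, a < 16 & i < 20]
  | SSeq c1 c2 => wf c1 && wf c2
  | SIf x c1 c2 => [&& x < 20, wf c1 & wf c2]
  | SSkip => true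
  end.

(** For [a < 16] the address [B + 16 * i + a] determines [i] and [a], and [22 < B] keeps it away
    from the registers; all separation arguments below rest on this. *)
Definition rep B (m : memory) st :=
  [/\ 22 < B, m 22 = B, forall x, x < 20 -> m x = sV st x &
      forall a i, a < 16 -> m (B + 16 * i + a) = sA st a i].

Lemma rep_scratch B m st r v : rep B m st -> 20 <= r < 22 -> rep B (upd m r v) st.
Proof.
move=> [h1 h2 h3 h4] hr; split=> //; first by rewrite upd_neq //; lia.
- by move=> x hx; rewrite upd_neq ?h3 //; lia.
- by move=> a i ha; rewrite upd_neq ?h4 //; lia.
Qed.

Lemma rep_setV B m st x v : rep B m st -> x < 20 -> rep B (upd m x v) (setV st x v).
Proof.
move=> [h1 h2 h3 h4] hr; split=> //; first by rewrite upd_neq //; lia.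
- move=> y hy /=; case: (PeanoNat.Nat.eqb_spec y x) => [->|hn]; first by rewrite upd_eq.
  by rewrite upd_neq ?h3.
- by move=> a i ha; rewrite upd_neq ?h4 //; lia.
Qed.

Lemma rep_setA B m st a i v : rep B m st -> a < 16 ->
  rep B (upd m (B + 16 * i + a) v) (setA st a i v).
Proof.
move=> [h1 h2 h3 h4] ha; split=> //; first by rewrite upd_neq //; lia.
- by move=> y hy /=; rewrite upd_neq ?h3 //; lia.
- move=> b j hb /=; case: (PeanoNat.Nat.eqb_spec b a) => [->|hn].
    rewrite /upd; case: (j =P i) => [->|hij]; first by rewrite eqxx.
    by case: eqP => [|_]; rewrite ?h4 //; lia.
  by rewrite upd_neq ?h4 //; lia.
Qed.

Lemma addr_effect B m st a i : rep B m st -> i < 20 ->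
  exists2 m', foldl effect m (addr_code a i) = upd m' 20 (B + 16 * sV st i + a) & rep B m' st.
Proof.
move=> hr hi; have [h1 h2 h3 h4] := hr.
exists (foldl effect m (take 6 (addr_code a i))); last first.
  by rewrite /=; do 6 (apply: rep_scratch => //).
rewrite /=; congr (upd _ _ _).
rewrite /upd /= h2 h3 //; lia.
Qed.

(** Compiled jumps only go forward, so each instruction runs at most once and the code size bounds
    the time. *)
Lemma comp_reach prog p c B m st :
  code_at prog p (comp p c) -> wf c -> rep B m st ->
  exists T m', [/\ T <= csize c, reach prog T p m (p + csize c) m' & rep B m' (den c st)].
Proof.
elim: c p m st => [x k|x y z|x y z|x a i|a i x|c1 IH1 c2 IH2|x c1 IH1 c2 IH2|] p m st hat hwf hr.
- exists 1; eexists; split=> //; first exact: (reach_basic _ hat).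
  by apply: rep_setV => //=; case/andP: hwf.
- exists 1; eexists; split=> //; first exact: (reach_basic _ hat).
  case/and3P: hwf => /andP[_ hx] hy hz; case: (hr) => _ _ h _.
  by rewrite /= -!h //; apply: rep_setV.
- exists 1; eexists; split=> //; first exact: (reach_basic _ hat).
  case/and3P: hwf => /andP[_ hx] hy hz; case: (hr) => _ _ h _.
  by rewrite /= -!h //; apply: rep_setV.
- case/and3P: hwf => /andP[_ hx] ha hi.
  exists 8; eexists; split=> //; first exact: (reach_basic _ hat).
  rewrite foldl_cat; have [m' -> hr'] := addr_effect a hr hi.
  rewrite [effect]lock /= -lock /= (@upd_eq m' 20 _ 20 erefl).
  have [h1 h2 h3 h4] := hr'; rewrite upd_neq; last lia.
  by rewrite h4 //; apply: rep_setV => //; apply: rep_scratch.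
- case/and3P: hwf => hx ha hi.
  exists 8; eexists; split=> //; first exact: (reach_basic _ hat).
  rewrite foldl_cat; have [m' -> hr'] := addr_effect a hr hi.
  rewrite [effect]lock /= -lock /= (@upd_eq m' 20 _ 20 erefl).
  have [h1 h2 h3 h4] := hr'; rewrite upd_neq; last lia.
  by rewrite h3 //; apply: rep_setA => //; apply: rep_scratch.
- case/andP: hwf => w1 w2; case/code_at_cat: hat => a1 a2.
  rewrite size_comp in a2.
  have [T1 [m1 [t1 r1 e1]]] := IH1 _ _ _ a1 w1 hr.
  have [T2 [m2 [t2 r2 e2]]] := IH2 _ _ _ a2 w2 e1.
  exists (T1 + T2), m2; split=> //; first exact: leq_add.
  by rewrite /= addnA; apply: reach_trans r1 r2.
- case/and3P: hwf => hx w1 w2.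
  case/code_at_cat: hat => /code_at_head[i1 _] /code_at_cat[a1 /code_at_cat[]].
  rewrite /= !size_comp addn1 => /code_at_head[i2 /code_at_head[i3 _]].
  rewrite (_ : p.+1 + csize c1 + 2 = p + csize c1 + 3); last lia.
  rewrite /= addn1 in a1 => a2; have [_ _ /(_ _ hx) hxx _] := hr.
  have := reach_jz m i1; rewrite hxx; case: ifP => _ r0.
    have [T2 [m2 [t2 r2 e2]]] := IH2 _ _ _ a2 w2 hr.
    exists (1 + T2), m2; split=> //; first by move: t2; lia.
    rewrite (_ : p + (csize c1 + csize c2 + 3) = p + csize c1 + 3 + csize c2); last lia.
    exact: reach_trans r0 r2.
  have [T1 [m1 [t1 r1 e1]]] := IH1 _ _ _ a1 w1 hr.
  exists (1 + (T1 + (1 + 1))), (upd m1 21 0); split=> //; first by move: t1; lia.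
    apply: reach_trans r0 _; apply: reach_trans r1 _.
    apply: reach_trans (reach_step _) _; first by rewrite /step i2.
    by have := reach_jz (upd m1 21 0) i3; rewrite upd_eq.
  exact: rep_scratch.
- by exists 0, m; split=> //; rewrite /= addn0.
Qed.

Lemma den_readonly c st x : wf c -> x < 2 -> sV (den c st) x = sV st x.
Proof.
move=> hwf hx; elim: c st hwf => //=.
- by move=> y k st hy; case: PeanoNat.Nat.eqb_spec => //; lia.
- by move=> y a b st hy; case: PeanoNat.Nat.eqb_spec => //; lia.
- by move=> y a b st hy; case: PeanoNat.Nat.eqb_spec => //; lia.
- by move=> y a b st hy; case: PeanoNat.Nat.eqb_spec => //; lia.
- by move=> c1 h1 c2 h2 st /andP[w1 w2]; rewrite h2 // h1.
- by move=> y c1 h1 c2 h2 st /and3P[_ w1 w2]; case: ifP; rewrite ?h1 ?h2.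
Qed.

(** Loops cannot be nested and always run over the input size in scalar 0, so an item costs at most
    its code size times [n + 1], whatever it computes. *)
Inductive item := Once of scmd | Loop of scmd.

(** The outer [setV] records the value that the compiled loop leaves in its counter. *)
Definition loop_den N c st :=
  setV (iteri N (fun j st => den c (setV st 1 j)) st) 1 N.

Definition item_den it st := match it with
  | Once c => den c st
  | Loop c => loop_den (sV st 0) c st
  end.

Definition item_size it := match it with Once c => csize c | Loop c => csize c + 7 end.
Definition item_comp p it := match it with
  | Once c => comp p c
  | Loop c => for_code 0 1 20 p (comp (p + 3) c)
  end.
Definition item_wf it := match it with Once c => wf c | Loop c => wf c end.

Fixpoint items_comp p its :=
  if its is it :: its' then item_comp p it ++ items_comp (p + item_size it) its' else [::].
Definition items_size its := foldr (fun it s => item_size it + s) 0 its.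
Definition items_den its st := foldl (fun st it => item_den it st) st its.

Lemma size_item_comp p it : size (item_comp p it) = item_size it.
Proof. by case: it => c; rewrite /item_comp ?size_for_code size_comp. Qed.

Lemma size_items_comp p its : size (items_comp p its) = items_size its.
Proof. by elim: its p => //= it its IH p; rewrite size_cat size_item_comp IH. Qed.

Lemma iteri_den_size N c st :
  wf c -> sV (iteri N (fun j st => den c (setV st 1 j)) st) 0 = sV st 0.
Proof. by move=> hw; elim: N => //= N IH; rewrite den_readonly. Qed.

Lemma item_den_size it st : item_wf it -> sV (item_den it st) 0 = sV st 0.
Proof. by case: it => c /= hw; [rewrite den_readonly | rewrite iteri_den_size]. Qed.

Lemma item_reach prog p it B m st :
  code_at prog p (item_comp p it) -> item_wf it -> rep B m st ->
  exists T m', [/\ T <= item_size it * (sV st 0 + 1),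
    reach prog T p m (p + item_size it) m' & rep B m' (item_den it st)].
Proof.
case: it => c /= hat hwf hr.
  have [T [m' [t r e]]] := comp_reach hat hwf hr.
  by exists T, m'; split=> //; apply: (leq_trans t); rewrite leq_pmulr // addn1.
pose f := fun N => iteri N (fun j st => den c (setV st 1 j)) st.
have := @for_reach prog p 0 1 20 _ (sV st 0) (csize c)
  (fun j m => rep B m (setV (f j) 1 j)) m hat erefl.
case=> //.
- move=> j mj [_ _ h _]; rewrite !h //=; split=> //.
  exact: iteri_den_size.
- by move=> j mj x h; apply: rep_scratch.
- move=> j mj hj h; have [_ /code_at_cat[hb _]] := code_at_cat hat.
  have [T [m' [t r e]]] := comp_reach hb hwf h.
  exists T, m'; rewrite size_comp; split=> //.
    by have [_ _ -> //] := e; rewrite den_readonly.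
  move=> x y; apply: rep_scratch => //.
  by apply: rep_setV => //; apply: rep_scratch.
- exact: rep_setV.
move=> T [m' [t r e]]; exists T, m'; split=> //; last by rewrite size_comp in r.
apply: (leq_trans t); move: (sV st 0) (csize c) => N s; nia.
Qed.

Lemma items_reach prog p its B m st :
  code_at prog p (items_comp p its) -> all item_wf its -> rep B m st ->
  exists T m', [/\ T <= items_size its * (sV st 0 + 1),
    reach prog T p m (p + items_size its) m' & rep B m' (items_den its st)].
Proof.
elim: its p m st => [|it its IH] p m st hat; first by exists 0, m; split=> //=; rewrite addn0.
move=> /= /andP[w1 w2] hr; case/code_at_cat: hat => a1 a2.
rewrite size_item_comp in a2.
have [T1 [m1 [t1 r1 e1]]] := item_reach a1 w1 hr.
have [T2 [m2 [t2 r2 e2]]] := IH _ _ _ a2 w2 e1.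
rewrite item_den_size // in t2.
exists (T1 + T2), m2; split=> //; first by rewrite mulnDl leq_add.
by rewrite addnA; apply: reach_trans r1 r2.
Qed.

(** * Moving the input out of the registers and the output back *)

Ltac upd_simpl := repeat match goal with
  | |- context [upd ?m ?a ?x ?b] =>
      first [rewrite (@upd_neq m a x b ltac:(lia)) | rewrite (@upd_eq m a x b ltac:(lia))]
  end.

(* The input occupies the very cells used as registers, so cells [2..22] are first moved, one by
   one, to their place in array [0], using only cells [0] and [1] (the number of colours stored in
   cell [1] is never needed). *)
Definition save_code s := flatten [seq [:: Add 1 1 2; StoreInd 1 r] | r <- s].

(** The base [64 + 3 * n] is past the input, which ends before cell [3 * n], and past the registers.
    Cell 2 is saved first because it then holds the stride 16. *)
Definition prologue_init :=
  [:: Const 1 64; Add 1 1 0; Add 1 1 0; Add 1 1 0; StoreInd 1 2; Const 2 16] ++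
  save_code (iota 3 20) ++ [:: Const 3 23; Add 4 0 0; Add 4 4 0; Const 6 1].

Definition prologue_body := [:: Add 1 1 2; LoadInd 8 3; StoreInd 1 8; Add 3 3 6].

Definition prologue_base := [:: Const 22 64; Add 22 22 0; Add 22 22 0; Add 22 22 0].

Definition prologue := prologue_init ++ for_code 4 5 7 50 prologue_body ++ prologue_base.

(** The bound [lo] separates the cells free for scratch use from those that must still hold their
    input value. *)
Definition saved n (inp : memory) lo K (m : memory) :=
  [/\ m 0 = n, forall i, i < K -> m (64 + 3 * n + 16 * i) = inp (i + 2) &
      forall a, lo <= a -> (forall i, i < K -> a <> 64 + 3 * n + 16 * i) -> m a = inp a].

Lemma saved_upd n inp lo K m r v : saved n inp lo K m -> 0 < r < lo -> lo <= 23 ->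
  saved n inp lo K (upd m r v).
Proof.
move=> [h1 h2 h3] hr hl; split; first by rewrite upd_neq //; lia.
- by move=> i hi; rewrite upd_neq ?h2 //; lia.
- by move=> a ha h; rewrite upd_neq ?h3 //; lia.
Qed.

Lemma saved_store n inp lo lo' K m : saved n inp lo K m -> lo <= lo' ->
  saved n inp lo' K.+1 (upd m (64 + 3 * n + 16 * K) (inp (K + 2))).
Proof.
move=> [h1 h2 h3] hl; split; first by rewrite upd_neq //; lia.
- move=> i hi; case: (i =P K) => [->|hn]; first by rewrite upd_eq.
  by rewrite upd_neq ?h2 //; lia.
- move=> a ha h; rewrite upd_neq ?h3 //; first lia.
    by move=> i hi; apply: h; lia.
  by apply: h.
Qed.

Lemma save_effect n inp k r m : 3 <= r -> r + k <= 23 ->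
  m 1 = 64 + 3 * n + 16 * (r - 3) -> m 2 = 16 -> saved n inp r (r - 2) m ->
  let m' := foldl effect m (save_code (iota r k)) in
  [/\ m' 1 = 64 + 3 * n + 16 * (r + k - 3), m' 2 = 16 & saved n inp (r + k) (r + k - 2) m'].
Proof.
elim: k r m => [|k IH] r m h3 hr e1 e2 hs; first by rewrite addn0.
rewrite (_ : save_code _ = [:: Add 1 1 2; StoreInd 1 r] ++ save_code (iota r.+1 k)) //.
rewrite foldl_cat -addSnnS /=; rewrite upd_eq // e1 e2.
rewrite (_ : 64 + 3 * n + 16 * (r - 3) + 16 = 64 + 3 * n + 16 * (r - 2)); last lia.
rewrite (upd_neq m _ (_ : r <> 1)); last lia.
have er : m r = inp r by case: hs => _ _ -> //; lia.
apply: IH => //; first lia.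
- lia.
- rewrite (_ : r.+1 - 2 = (r - 2).+1); last lia.
  have := @saved_upd _ _ _ _ _ 1 (64 + 3 * n + 16 * (r - 2)) hs ltac:(lia) ltac:(lia).
  move=> /saved_store /(_ (leqnSn r)); rewrite er subnK //; lia.
Qed.

(** All arrays other than array 0 start at zero without being initialised, because the cells from
    the base on are past the input. *)
Lemma prologue_reach prog n (inp : memory) :
  code_at prog 0 prologue -> inp 0 = n -> (forall a, 3 * n <= a -> 1 < a -> inp a = 0) ->
  exists T m st, [/\ T <= 57 + 30 * n, reach prog T 0 inp 65 m,
    rep (64 + 3 * n) m st, sV st 0 = n &
    sA st = fun a i => if a == 0 then inp (i + 2) else 0].
Proof.
move=> hat h0 hz.
case/code_at_cat: hat => a1 /code_at_cat[a2 a3].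
rewrite size_for_code /= in a2 a3.
have r1 := reach_basic inp a1 erefl.
set m1 := foldl effect inp prologue_init in r1.
have [s1 s2 s3 s4] : [/\ m1 1 = 64 + 3 * n + 16 * 20, m1 3 = 23, m1 4 = 3 * n &
    [/\ m1 6 = 1, m1 2 = 16 & saved n inp 23 21 m1]].
  rewrite /m1 /prologue_init; move: (save_code _) (@save_effect n inp 20 3) => sc hsc.
  rewrite foldl_cat foldl_cat; set m0 := foldl _ inp _.
  have [] := hsc m0 => //.
  - by rewrite /m0 /=; upd_simpl; rewrite h0; lia.
  - rewrite /m0 [foldl _ _ _]/=; apply: saved_upd => //.
    set M := upd (upd _ _ _) 1 _.
    have -> : M 1 = 64 + 3 * n + 16 * 0 by rewrite /M; upd_simpl; rewrite h0; lia.
    have -> : M 2 = inp (0 + 2) by rewrite /M; upd_simpl.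
    apply: (@saved_store _ _ 2) => //.
    rewrite /M; do 4 (apply: saved_upd => //); by split.
  move: (foldl _ m0 sc) => m2 e1 e2 hs; have [f1 _ _] := hs.
  split.
  - by rewrite /=; upd_simpl.
  - by rewrite /=; upd_simpl.
  - by rewrite /=; upd_simpl; rewrite f1; lia.
  - split; [by rewrite /=; upd_simpl | by rewrite /=; upd_simpl |].
    by rewrite /=; do 4 (apply: saved_upd => //).
clearbody m1.
have [] := @for_reach prog 50 4 5 7 prologue_body (3 * n) 4
  (fun j m => [/\ m 1 = 64 + 3 * n + 16 * (20 + j), m 3 = 23 + j, m 4 = 3 * n, m 5 = j &
     [/\ m 6 = 1, m 2 = 16 & saved n inp 23 (21 + j) m]]) m1 a2 erefl.
- by move=> j m [].
- move=> j m x [t1 t3 t4 t5 [t6 t2 t7]]; split; upd_simpl => //.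
  by split; upd_simpl => //; apply: saved_upd.
- move=> j m hj [t1 t3 t4 t5 [t6 t2 t7]].
  case/code_at_cat: a2 => _ /code_at_cat[b2 _].
  exists 4; eexists; split=> //; first exact: (reach_basic m b2 erefl).
    by rewrite /=; upd_simpl.
  (* As [j < 3 * n], the source cell lies below the base, so no earlier store has hit it. *)
  have er : m (23 + j) = inp (21 + j + 2).
    case: (t7) => _ _ h; rewrite (h _ _ _); [by congr inp; lia | by [] |].
    by move=> i hi; lia.
  move=> x y; rewrite [foldl _ _ _]/=; split.
  + by upd_simpl; lia.
  + by upd_simpl; lia.
  + by upd_simpl.
  + by upd_simpl.
  split; [by upd_simpl | by upd_simpl |].
  do 4 (apply: saved_upd => //).
  upd_simpl; rewrite t3 er t1 t2.
  rewrite (_ : 64 + 3 * n + 16 * (20 + j) + 16 = 64 + 3 * n + 16 * (21 + j)); last lia.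
  rewrite addnS; apply: (saved_store _ (leqnn _)).
  by do 2 (apply: saved_upd => //).
- case: s4 => u6 u2 u7; split; upd_simpl => //; last by split; upd_simpl => //; apply: saved_upd.
move=> T [m [t r [e1 e3 e4 e5 [e6 e2 hs]]]].
have r3 := reach_basic m a3 erefl.
have hs' : saved n inp 23 (21 + 3 * n) (foldl effect m prologue_base).
  by rewrite /=; do 4 (apply: saved_upd => //).
have e22 : foldl effect m prologue_base 22 = 64 + 3 * n.
  by have [h _ _] := hs; rewrite /=; upd_simpl; rewrite h; lia.
move: (foldl _ _ prologue_base) hs' r3 e22 => m' hs' r3 e22.
exists (size prologue_init + (T + size prologue_base)), m'.
exists (State m' (fun a i => if a == 0 then inp (i + 2) else 0)); split=> //.
- by move: t; rewrite /=; lia.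
- by apply: reach_trans r1 _; apply: reach_trans r r3.
- split=> // a i ha.
  case: hs' => _ h1 h2 /=; case: eqP => [->|hn0].
    case: (ltnP i (21 + 3 * n)) => hi; first by rewrite addn0 h1.
    by rewrite addn0 h2 ?hz //; lia.
  by rewrite h2 ?hz //; lia.
- by case: hs'.
Qed.

Definition epilogue_addr s := flatten [seq [:: Const r (16 * r); Add r r 0] | r <- s].
Definition epilogue_load s := [seq LoadInd r r | r <- s].

Definition epilogue_body := [:: LoadInd 8 3; StoreInd 4 8; Add 3 3 2; Add 4 4 5].

(* Finally each register is loaded with the address of its own output value, so that the
   last [23] cells can be filled by [LoadInd r r] without any further register. *)
Definition epilogue_tail out :=
  [:: Const 1 out; Const 0 0; Add 0 0 22; Add 0 0 1] ++
  epilogue_addr (iota 1 22) ++ epilogue_load (iota 0 23).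

(** The loop copies the outputs from index 23 on while the registers are still in use. It runs past
    index [n], harmlessly, since the cells below [23 + n] are under the base of the arrays. *)
Definition epilogue out p :=
  [:: Const 3 (16 * 23 + out); Add 3 3 22; Const 4 23; Const 2 16; Const 5 1] ++
  for_code 0 1 7 (p + 5) epilogue_body ++ epilogue_tail out.

Lemma epilogue_addr_effect b k r (m : memory) : 0 < r -> r + k <= 23 -> m 0 = b ->
  (forall x, 0 < x < r -> m x = b + 16 * x) ->
  let m' := foldl effect m (epilogue_addr (iota r k)) in
  [/\ m' 0 = b, forall x, 0 < x < r + k -> m' x = b + 16 * x & forall x, 23 <= x -> m' x = m x].
Proof.
elim: k r m => [|k IH] r m hr hk e0 hx; first by rewrite addn0.
rewrite (_ : epilogue_addr _ = [:: Const r (16 * r); Add r r 0] ++ epilogue_addr (iota r.+1 k)) //.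
rewrite foldl_cat -addSnnS /=; upd_simpl.
have [] := IH r.+1 (upd (upd m r (16 * r)) r (16 * r + m 0)) => //; first by lia.
- by upd_simpl.
- move=> x hx'; case: (x =P r) => [->|hn]; upd_simpl; first lia.
  by rewrite hx //; lia.
move=> h1 h2 h3; split=> // x hx'; rewrite h3 //; upd_simpl => //.
Qed.

Lemma epilogue_load_effect b k r (m : memory) : r + k <= 23 -> 23 <= b ->
  (forall x, r <= x < r + k -> m x = b + 16 * x) ->
  let m' := foldl effect m (epilogue_load (iota r k)) in
  [/\ forall x, x < r -> m' x = m x, forall x, r <= x < r + k -> m' x = m (b + 16 * x) &
      forall x, 23 <= x -> m' x = m x].
Proof.
elim: k r m => [|k IH] r m hk hb hx; first by split=> // x; lia.
rewrite -addSnnS /=; have hr : m r = b + 16 * r by rewrite hx //; lia.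
have [] := IH r.+1 (upd m r (m (m r))); first lia; first by [].
- by move=> x hx'; upd_simpl; rewrite hx //; lia.
move=> h1 h2 h3; split=> x hx'; last by rewrite h3 //; upd_simpl.
  by rewrite h1; [upd_simpl | lia].
case: (x =P r) => [->|hn]; first by rewrite h1; [upd_simpl; rewrite hr | lia].
by rewrite h2; [upd_simpl | lia].
Qed.

Lemma epilogue_reach prog p out n m st :
  code_at prog p (epilogue out p) -> out < 16 -> rep (64 + 3 * n) m st -> sV st 0 = n ->
  exists T m', [/\ T <= 84 + 10 * n, reach prog T p m (p + 87) m' &
    forall v, v < n -> m' v = sA st out v].
Proof.
move=> hat ho [r1 r2 r3 r4] hn.
case/code_at_cat: hat => a1 /code_at_cat[a2 a3].
rewrite size_for_code -addnA in a3.
have {}a3 : code_at prog (p + 16) (epilogue_tail out) := a3.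
have s1 := reach_basic m a1 erefl.
set m1 := foldl effect m _ in s1.
have i1 : [/\ m1 0 = n, m1 22 = 64 + 3 * n, m1 3 = 64 + 3 * n + 16 * 23 + out, m1 4 = 23 &
    [/\ m1 2 = 16, m1 5 = 1 & forall x, 23 <= x -> m1 x = m x]].
  rewrite /m1 /=; split; upd_simpl => //; first by rewrite r3.
    by rewrite r2; lia.
  by split=> [||x hx]; upd_simpl.
clearbody m1.
have [] := @for_reach prog (p + 5) 0 1 7 epilogue_body n 4
  (fun j m => [/\ m 0 = n, m 22 = 64 + 3 * n, m 3 = 64 + 3 * n + 16 * (23 + j) + out, 
    m 4 = 23 + j & [/\ m 1 = j, m 2 = 16, m 5 = 1,
      forall x, 64 + 3 * n <= x -> m x = m1 x & 
      forall v, 23 <= v < 23 + j -> m v = sA st out v]]) m1 a2 erefl.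
- by move=> j m' [? ? ? ? [? ? ? ? ?]].
- move=> j m' x [t0 t22 t3 t4 [t1 t2 t5 tx tv]]; split; upd_simpl => //.
  by split; upd_simpl => // y hy; upd_simpl; (exact: tx || exact: tv).
- move=> j m' hj [t0 t22 t3 t4 [t1 t2 t5 tx tv]].
  case/code_at_cat: a2 => _ /code_at_cat[b2 _].
  exists 4; eexists; split=> //; first exact: (reach_basic m' b2 erefl).
    by rewrite /=; upd_simpl.
  move=> x y; rewrite [foldl _ _ _]/=; split; upd_simpl => //; try lia.
  split; upd_simpl => //.
    by move=> z hz; upd_simpl; apply: tx.
  move=> v hv; case: (v =P 23 + j) => [->|hne]; last by upd_simpl; apply: tv; lia.
  upd_simpl; rewrite t3 tx; last lia.
  case: i1 => _ _ _ _ [_ _ ->]; last lia.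
  by rewrite r4.
- case: i1 => t0 t22 t3 t4 [t2 t5 tx]; split; upd_simpl => //.
  by split; upd_simpl => // x hx; upd_simpl; lia.
move=> T [m2 [t s2 [t0 t22 t3 t4 [t1 t2 t5 tx tv]]]].
have s3 := reach_basic m2 a3 erefl.
exists (5 + (T + 71)), (foldl effect m2 (epilogue_tail out)); split.
- by move: t; lia.
- apply: reach_trans s1 _; apply: reach_trans s2 _.
  by move: s3; rewrite -!addnA.
move=> v hv; rewrite foldl_cat; set m3 := foldl effect m2 _.
have [w0 wx] : m3 0 = 64 + 3 * n + out /\ forall x, 23 <= x -> m3 x = m2 x.
  by rewrite /m3 /=; split=> [|x hx]; upd_simpl; rewrite ?t22; lia.
rewrite foldl_cat.
have [] := @epilogue_addr_effect (64 + 3 * n + out) 22 1 m3 => //; first by move=> x; lia.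
move: (foldl _ _ _) => m4 g0 g1 g2.
have [] := @epilogue_load_effect (64 + 3 * n + out) 23 0 m4 => //.
  by move=> [|x] hx; rewrite ?g0 ?g1 //; lia.
move=> _ f1 f2; case: (ltnP v 23) => hv'.
  rewrite f1 // g2; last lia.
  rewrite wx; last lia.
  rewrite tx; last lia.
  case: i1 => _ _ _ _ [_ _ ->]; last lia.
  by rewrite addnAC r4.
by rewrite f2 // g2 // wx // tv //; lia.
Qed.

(** * The program *)

Fixpoint writesV x c := match c with
  | SConst y _ | SAdd y _ _ | SSub y _ _ | SLd y _ _ => Nat.eqb x y
  | SSeq c1 c2 | SIf _ c1 c2 => writesV x c1 || writesV x c2
  | _ => false
  end.
Fixpoint writesA a c := match c with
  | SSt b _ _ => Nat.eqb a b
  | SSeq c1 c2 | SIf _ c1 c2 => writesA a c1 || writesA a c2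
  | _ => false
  end.

Lemma den_frameV x c st : ~~ writesV x c -> sV (den c st) x = sV st x.
Proof.
elim: c st => //= [y k|y a b|y a b|y a b|c1 h1 c2 h2|y c1 h1 c2 h2] st.
1-4: by case: Nat.eqb.
- by rewrite negb_or => /andP[w1 w2]; rewrite h2 // h1.
- by rewrite negb_or => /andP[w1 w2]; case: ifP; rewrite ?h1 ?h2.
Qed.

Lemma den_frameA a c st : ~~ writesA a c -> sA (den c st) a = sA st a.
Proof.
elim: c st => //= [b i y|c1 h1 c2 h2|y c1 h1 c2 h2] st.
- by case: Nat.eqb.
- by rewrite negb_or => /andP[w1 w2]; rewrite h2 // h1.
- by rewrite negb_or => /andP[w1 w2]; case: ifP; rewrite ?h1 ?h2.
Qed.

Definition item_writesV x it := match it with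
  | Once c => writesV x c | Loop c => Nat.eqb x 1 || writesV x c end.
Definition item_writesA a it := match it with Once c | Loop c => writesA a c end.

Lemma items_frameV x its st : ~~ has (item_writesV x) its ->
  sV (items_den its st) x = sV st x.
Proof.
elim: its st => //= it its IH st; rewrite negb_or => /andP[w1 w2].
rewrite /items_den /= -/(items_den _ _) IH //; case: it w1 => c /=.
  exact: den_frameV.
rewrite negb_or => /andP[/negPf h1 h2]; rewrite h1; elim: (sV st 0) => //= N IHN.
by rewrite den_frameV //= h1.
Qed.

Lemma items_frameA a its st : ~~ has (item_writesA a) its ->
  sA (items_den its st) a = sA st a.
Proof.
elim: its st => //= it its IH st; rewrite negb_or => /andP[w1 w2].
rewrite /items_den /= -/(items_den _ _) IH //; case: it w1 => c /=.
  exact: den_frameA.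
move=> h1; elim: (sV st 0) => //= N IHN.
by rewrite den_frameA.
Qed.

Lemma item_frameV x it st : ~~ item_writesV x it -> sV (item_den it st) x = sV st x.
Proof. by move=> h; apply: (@items_frameV x [:: it]); rewrite /= orbF. Qed.

Lemma item_frameA a it st : ~~ item_writesA a it -> sA (item_den it st) a = sA st a.
Proof. by move=> h; apply: (@items_frameA a [:: it]); rewrite /= orbF. Qed.

Lemma items_den_cat i1 i2 st : items_den (i1 ++ i2) st = items_den i2 (items_den i1 st).
Proof. exact: foldl_cat. Qed.

Lemma loop_ind (I : nat -> state -> Prop) N c st :
  I 0 st -> (forall j s, j < N -> I j s -> I j.+1 (den c (setV s 1 j))) ->
  (forall s, I N s -> I N (setV s 1 N)) -> I N (loop_den N c st).
Proof.
move=> h0 hS hend; apply: hend.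
have : forall K, K <= N -> I K (iteri K (fun j s => den c (setV s 1 j)) st).
  by elim=> //= K IH hK; apply: hS => //; apply: IH; apply: ltnW.
exact.
Qed.

Fixpoint seqs cs := if cs is c :: cs' then SSeq c (seqs cs') else SSkip.

(* Arrays: 0 input, 1 colour multiplicities, 2 degrees, 3 marks [u], 4 leaves of [u], 5 leaves of [v],
   6, 7, 8 and 9, 10, 11 fill level and current cluster of each colour and label of each vertex for
   the two orders, 12 output.  Scalars: 5 gcd, 9 and 10 the ends [u] and [v] of the dominating edge,
   8 and 11 the numbers of internal edges, 12 and 13 the partners of [u] and [v] if [d = 1]. *)
Definition ph_count :=
  [:: Loop (seqs [:: SLd 2 0 1; SLd 3 1 2; SConst 4 1; SAdd 3 3 4; SSt 1 2 3])].

(* One step of Euclid's algorithm by subtraction on scalars 5 and 6; when scalar 6 is exhausted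
   the next multiplicity is fetched.  The sum of all the numbers involved decreases, so [3 n]
   steps suffice. *)
Definition gcd_step :=
  SIf 6 (SSeq (SSub 2 5 6) (SIf 2 (SSub 5 5 6) (SSub 6 6 5)))
        (seqs [:: SLd 6 1 7; SConst 2 1; SAdd 7 7 2]).

Definition ph_gcd :=
  [:: Once (seqs [:: SConst 2 0; SAdd 5 0 2; SConst 6 0; SConst 7 0]);
      Loop gcd_step; Loop gcd_step; Loop gcd_step].

(* Runs [c] with the endpoints of the [i]-th edge in scalars 3 and 4, provided [i < n - 1]. *)
Definition with_edge c :=
  seqs [:: SSub 2 0 1; SConst 3 1; SSub 2 2 3;
    SIf 2 (seqs [:: SAdd 2 0 1; SAdd 2 2 1; SLd 3 0 2; SConst 4 1; SAdd 2 2 4; SLd 4 0 2; c])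
      SSkip].

Definition ph_degree :=
  [:: Loop (with_edge (seqs [:: SLd 2 2 3; SConst 14 1; SAdd 2 2 14; SSt 2 3 2;
                               SLd 2 2 4; SAdd 2 2 14; SSt 2 4 2]))].

(** The truncated difference of [n] and the degree sum vanishes when the sum is at least [n];
    [dominates_of_degrees] shows that this inequality suffices. *)
Definition ph_center :=
  [:: Once (seqs [:: SConst 9 0; SConst 10 0]);
      Loop (with_edge (seqs [:: SLd 2 2 3; SLd 14 2 4; SAdd 2 2 14; SSub 2 0 2;
        SIf 2 SSkip (seqs [:: SConst 14 0; SAdd 9 3 14; SAdd 10 4 14])]))].

(** A single mark at index [u] turns the test whether an endpoint equals [u] into a lookup. Being a
    neighbour of [u], the vertex [v] gets marked as well and is cleared at the end. *)
Definition ph_leaves_u :=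
  [:: Once (seqs [:: SConst 2 1; SSt 3 9 2]);
      Loop (with_edge (seqs [:: SLd 2 3 3; SIf 2 (SSt 4 4 2) SSkip;
                               SLd 2 3 4; SIf 2 (SSt 4 3 2) SSkip]));
      Once (seqs [:: SConst 2 0; SSt 4 10 2])].

Definition ph_leaves_v :=
  [:: Loop (seqs [:: SLd 2 4 1; SIf 2 SSkip (seqs [:: SConst 2 1; SSt 5 1 2])]);
      Once (seqs [:: SConst 2 0; SSt 5 9 2; SSt 5 10 2])].

Definition fill_id (b : bool) := if b then 6 else 9.
Definition cur_id (b : bool) := if b then 7 else 10.
Definition lab_id (b : bool) := if b then 8 else 11.

(* Vertex [x] gets the current cluster of its colour; the fill level grows by [gcd] and wraps at
   the multiplicity [N] of the colour, so every [N / gcd] vertices the cluster advances. *)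
Definition assign b x :=
  seqs [:: SLd 14 0 x; SLd 15 (cur_id b) 14; SSt (lab_id b) x 15; SLd 16 (fill_id b) 14;
    SAdd 16 16 5; SLd 17 1 14; SSub 17 17 16;
    SIf 17 (SSt (fill_id b) 14 16)
      (seqs [:: SConst 16 0; SSt (fill_id b) 14 16; SConst 16 1; SAdd 15 15 16;
                SSt (cur_id b) 14 15])].

Definition assign_loop b a := Loop (seqs [:: SLd 2 a 1; SIf 2 (assign b 1) SSkip]).

Definition ph_split :=
  [:: Once (assign true 9); assign_loop true 4; assign_loop true 5; Once (assign true 10)].

Definition ph_merge :=
  [:: Once (assign false 9); Once (assign false 10); assign_loop false 4; assign_loop false 5].

(** Equality is tested through truncated subtraction: [x - y + (y - x)] is zero exactly when
    [x = y]. *)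
Definition compare b s :=
  seqs [:: SLd 14 (lab_id b) 3; SLd 15 (lab_id b) 4; SSub 16 14 15; SSub 17 15 14;
    SAdd 16 16 17; SIf 16 SSkip (seqs [:: SConst 17 1; SAdd s s 17])].

Definition ph_score :=
  [:: Once (seqs [:: SConst 8 0; SConst 11 0]);
      Loop (with_edge (SSeq (compare true 8) (compare false 11)))].

(** Both partners default to [v]; the reason why one default suits both centres is given at
    [matching_label]. *)
Definition ph_pick :=
  [:: Once (seqs [:: SConst 2 0; SAdd 12 10 2; SAdd 13 10 2]);
      Loop (seqs [:: SConst 3 0; SLd 2 4 1; SIf 2 (SAdd 12 1 3) SSkip;
                    SLd 2 5 1; SIf 2 (SAdd 13 1 3) SSkip])].

(** As [n = g * d], the difference [n - g] vanishes exactly when [d = 1]. *)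
Definition ph_out :=
  [:: Loop (seqs [:: SSub 2 0 5;
        SIf 2 (seqs [:: SSub 3 8 11; SIf 3 (SLd 4 8 1) (SLd 4 11 1); SSt 12 1 4])
              (SSt 12 1 1)]);
      Once (SSeq (SSub 2 0 5) (SIf 2 SSkip (SSeq (SSt 12 9 12) (SSt 12 10 13))))].

Definition main_items :=
  ph_count ++ ph_gcd ++ ph_degree ++ ph_center ++ ph_leaves_u ++ ph_leaves_v ++ ph_split ++ ph_merge ++
  ph_score ++ ph_pick ++ ph_out.

Lemma main_items_wf : all item_wf main_items.
Proof. by []. Qed.

(** * Colour multiplicities, their gcd, degrees and leaves *)

Lemma count_spec st : (forall i, sA st 1 i = 0) ->
  forall i, sA (items_den ph_count st) 1 i = count (fun x => sA st 0 x == i) (iota 0 (sV st 0)).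
Proof.
move=> h0; rewrite /items_den /=.
pose I j s := sA s 0 = sA st 0 /\
  forall i, sA s 1 i = count (fun x => sA st 0 x == i) (iota 0 j).
have [] : I (sV st 0) (loop_den (sV st 0)
    (seqs [:: SLd 2 0 1; SLd 3 1 2; SConst 4 1; SAdd 3 3 4; SSt 1 2 3]) st).
  apply: loop_ind => // j s hj [h1 h2]; split=> // i.
  rewrite -[j.+1]addn1 iotaD count_cat -h2 /= addn0 /upd h1 eq_sym.
  by case: eqP => [<-|]; rewrite ?addn1 ?addn0.
by [].
Qed.

(** The common divisors are preserved, while a potential pays for the [t] steps made: the two
    current numbers, the multiplicities not yet fetched and how many these are. It starts at
    [n + 0 + n + n]. In the final alternative everything has been absorbed, and further steps only
    fetch zeros. *)
Definition gcd_inv n C t st :=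
  [/\ sA st 1 = C, 0 < sV st 5,
      forall q, (q %| n /\ forall i, q %| C i) <->
         [/\ q %| sV st 5, q %| sV st 6 & forall i, sV st 7 <= i -> q %| C i] &
      (sV st 5 + sV st 6 + \sum_(sV st 7 <= i < n) C i + (n - sV st 7) + t <= 3 * n) \/
      (sV st 6 = 0 /\ n <= sV st 7)].

Lemma gcd_step_spec n C t st x : (forall i, n <= i -> C i = 0) ->
  gcd_inv n C t st -> gcd_inv n C t.+1 (den gcd_step (setV st 1 x)).
Proof.
move=> hC [h1 h2 h3 h4].
rewrite /gcd_step /=; case: eqP => [e6|/eqP n6] /=.
  split=> //=.
    move=> q; rewrite h3 e6 h1; split=> [[q1 q2 q3]|[q1 q2 q3]]; split=> //.
    - exact: q3.
    - by move=> i hi; apply: q3; lia.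
    - by move=> i hi; case: (i =P sV st 7) => [->|hn] //; apply: q3; lia.
  case: (leqP n (sV st 7)) => hn; first by right; rewrite h1 hC //; lia.
  left; case: h4 => [|[_]]; last by rewrite leqNgt hn.
  rewrite big_ltn // h1 e6 addn1; move: (\sum_(_ <= i < n) _) => S; lia.
case: eqP => [e|/eqP e] /=.
  split=> //=.
    move=> q; rewrite h3; split=> [[q1 q2 q3]|[q1 q2 q3]]; split=> //.
    - by rewrite dvdn_sub.
    - by rewrite -(subnK (_ : sV st 5 <= sV st 6)) ?dvdn_add //; lia.
  case: h4 => [h|[]]; last by move/eqP: n6.
  left; lia.
split=> //=; first lia.
  move=> q; rewrite h3; split=> [[q1 q2 q3]|[q1 q2 q3]]; split=> //.
  - by rewrite dvdn_sub.
  - by rewrite -(subnK (_ : sV st 6 <= sV st 5)) ?dvdn_add //; lia.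
case: h4 => [h|[]]; last by move/eqP: n6.
left; lia.
Qed.

Lemma gcd_loop_spec n C t st N : (forall i, n <= i -> C i = 0) ->
  gcd_inv n C t st -> gcd_inv n C (t + N) (loop_den N gcd_step st).
Proof.
move=> hC h; apply: (@loop_ind (fun j s => gcd_inv n C (t + j) s)) => //; first by rewrite addn0.
by move=> j s hj hs; rewrite addnS; apply: gcd_step_spec.
Qed.

(** The computation starts from [n], which keeps scalar 5 positive and does not change the gcd
    because [n] is the sum of the multiplicities. *)
Lemma gcd_spec st : 0 < sV st 0 -> (forall i, sV st 0 <= i -> sA st 1 i = 0) ->
  \sum_(0 <= i < sV st 0) sA st 1 i = sV st 0 ->
  0 < sV (items_den ph_gcd st) 5 /\
  forall q, q %| sV (items_den ph_gcd st) 5 <-> (q %| sV st 0 /\ forall i, q %| sA st 1 i).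
Proof.
move=> hn hC hs; set n := sV st 0 in hn hC hs *; set C := sA st 1 in hC hs *.
have [_ g0 hg hfin] : gcd_inv n C (0 + n + n + n) (items_den ph_gcd st).
  set st1 := den (seqs [:: SConst 2 0; SAdd 5 0 2; SConst 6 0; SConst 7 0]) st.
  have step s t : sV s 0 = n -> gcd_inv n C t s ->
      sV (item_den (Loop gcd_step) s) 0 = n /\ gcd_inv n C (t + n) (item_den (Loop gcd_step) s).
    by move=> e i; rewrite item_den_size //= e; split=> //; apply: gcd_loop_spec.
  have e1 : sV st1 0 = n by [].
  have i1 : gcd_inv n C 0 st1.
    split=> //=; first by rewrite addn0.
      by move=> q; rewrite addn0 dvdn0; split=> [[q1 q2]|[q1 q2 q3]]; split=> // i; apply: q3.
    by left; rewrite hs -/n; lia.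
  have [e2 i2] := step _ _ e1 i1; have [e3 i3] := step _ _ e2 i2.
  by have [] := step _ _ e3 i3.
(* After [3 * n] steps the potential bound leaves no room for the positive scalar 5. *)
case: hfin => [|[e6 e7]]; first lia.
split=> // q; rewrite hg; split=> [h|[]] //; split=> //; first by rewrite e6.
by move=> i hi; rewrite hC //; lia.
Qed.

Definition raw_edges n (r : nat -> nat) (L : seq (nat * nat)) :=
  size L = n.-1 /\ forall j, j < size L ->
    (r (n + j + j), r (n + j + j + 1)) = nth (0, 0) L j.

(** The invariant is indexed by the edges already seen and must survive writes to scalars 1 to 4,
    which [with_edge] itself uses. Of the [n] rounds the last finds no edge and does nothing. *)
Lemma edge_loop (I : seq (nat * nat) -> state -> Prop) c n r L st :
  0 < n -> sV st 0 = n -> sA st 0 = r -> raw_edges n r L ->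
  wf c -> ~~ writesA 0 c ->
  (forall l s x v, 0 < x < 5 -> I l s -> I l (setV s x v)) ->
  (forall l p s, p \in L -> sV s 0 = n -> sV s 3 = p.1 -> sV s 4 = p.2 -> I l s ->
     I (rcons l p) (den c s)) ->
  I [::] st -> I L (item_den (Loop (with_edge c)) st).
Proof.
move=> n0 hn hr [hsz hL] hwf hw hst hstep h0; rewrite /= hn.
have [] // := @loop_ind (fun j s => [/\ sV s 0 = n, sA s 0 = r & I (take j L) s]) n (with_edge c) st.
- by rewrite take0.
- move=> j s hj [e0 er hI].
  have hI1 : I (take j L) (setV s 1 j) by apply: hst.
  have hI2 : I (take j L) (setV (setV (setV (setV s 1 j) 2 (n - j)) 3 1) 2 (n - j - 1)).
    by do 3 (apply: (hst) => //).
  rewrite /with_edge [den _ _]/= e0 /=.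
  case: eqP => [hz|/eqP hz].
    split=> //=; rewrite take_oversize; last by rewrite hsz; lia.
    by rewrite take_oversize in hI2; last by rewrite hsz; lia.
  have hjL : j < size L by rewrite hsz; lia.
  set s1 := setV _ 4 _.
  split; first by rewrite den_readonly.
    by rewrite den_frameA.
  rewrite (take_nth (0, 0)) //; have hp := hL _ hjL.
  apply: hstep; rewrite ?mem_nth // -?hp /= ?er ?e0 //.
  by do 6 (apply: (hst) => //).
by move=> s [e0 er hI]; split=> //; apply: hst.
by move=> _ _; rewrite take_oversize // hsz; lia.
Qed.

Lemma degree_spec n r L st : 0 < n -> sV st 0 = n -> sA st 0 = r -> raw_edges n r L ->
  (forall x, sA st 2 x = 0) ->
  forall x, sA (items_den ph_degree st) 2 x = \sum_(p <- L) ((p.1 == x) + (p.2 == x)).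
Proof.
move=> n0 hn hr hL h0.
apply: (@edge_loop (fun l s => forall x, sA s 2 x = \sum_(p <- l) ((p.1 == x) + (p.2 == x)))
   _ n r L) => //; last by move=> x; rewrite big_nil.
- move=> l [a b] s _ _ /= e3 e4 hI x; rewrite big_rcons /= /upd e3 e4 -hI ![_ == x]eq_sym.
  case: (x =P b) => [->|hb]; first by case: (b =P a) => [->|ha]; rewrite ?hI; lia.
  by case: (x =P a) => [->|ha]; rewrite ?hI; lia.
Qed.

Lemma center_spec n r L st D : 0 < n -> sV st 0 = n -> sA st 0 = r -> raw_edges n r L ->
  sA st 2 = D -> let st' := items_den ph_center st in
  (L = [::] -> sV st' 9 = 0 /\ sV st' 10 = 0) /\
  (has (fun p => n <= D p.1 + D p.2) L ->
   (sV st' 9, sV st' 10) \in [seq p <- L | n <= D p.1 + D p.2]).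
Proof.
move=> n0 hn hr hL hD.
pose I l s := [/\ sA s 2 = D, l = [::] -> sV s 9 = 0 /\ sV s 10 = 0 &
  has (fun p => n <= D p.1 + D p.2) l ->
  (sV s 9, sV s 10) \in [seq p <- l | n <= D p.1 + D p.2]].
have [] // : I L (items_den ph_center st).
apply: (@edge_loop I _ n r L) => //.
- by move=> l s [|[|[|[|[|x]]]]] w.
- move=> l [a b] s _ e0 e3 e4 [h1 h2 h3].
  rewrite /= e0 e3 e4 h1 /=; case: eqP => h; split=> //=.
  + by case: l {h2 h3}.
  + move=> _; rewrite mem_filter /= mem_rcons in_cons !addn0 eqxx /= andbT; lia.
  + by case: l {h2 h3}.
  + rewrite has_rcons /= (_ : (n <= _) = false) /=; last lia.
    by move=> /h3; rewrite !mem_filter mem_rcons in_cons => /andP[-> ->]; rewrite orbT.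
Qed.

Lemma leaves_u_spec n r L st u v : 0 < n -> sV st 0 = n -> sA st 0 = r -> raw_edges n r L ->
  sV st 9 = u -> sV st 10 = v -> (forall x, sA st 3 x = 0) -> (forall x, sA st 4 x = 0) ->
  forall x, (sA (items_den ph_leaves_u st) 4 x != 0) =
    [&& x != v & ((u, x) \in L) || ((x, u) \in L)].
Proof.
move=> n0 hn hr hL hu hv h30 h40.
pose I (l : seq (nat * nat)) s := [/\ sV s 9 = u, sV s 10 = v, forall x, (sA s 3 x != 0) = (x == u) &
  forall x, (sA s 4 x != 0) = ((u, x) \in l) || ((x, u) \in l)].
set s1 := item_den (Once (seqs [:: SConst 2 1; SSt 3 9 2])) st.
have : I L (item_den (Loop (with_edge (seqs [:: SLd 2 3 3; SIf 2 (SSt 4 4 2) SSkip;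
                               SLd 2 3 4; SIf 2 (SSt 4 3 2) SSkip]))) s1).
  apply: (@edge_loop I _ n r L) => //.
  - by move=> l s [|[|[|[|[|x]]]]] w.
  - move=> l [a b] s _ e0 /= e3 e4 [h1 h2 h3 h4].
    have h3' y : (sA s 3 y == 0) = (y != u) by rewrite -h3 negbK.
    have e x : (((u, x) \in rcons l (a, b)) || ((x, u) \in rcons l (a, b))) =
      [|| (a == u) && (x == b), (b == u) && (x == a) | sA s 4 x != 0].
      rewrite h4 !mem_rcons !in_cons !xpair_eqE ![u == _]eq_sym.
      by move: (a == u) (x == b) (x == a) (b == u) ((u, x) \in l) ((x, u) \in l) => [] [] [] [] [] [].
    rewrite e3 h3'; case: (eqVneq a u) => ha /=; rewrite ?e3 ?e4 h3';
      case: (eqVneq b u) => hb; split=> //= x; rewrite ?e3 ?e4 e ?ha ?hb ?eqxx /upd //=.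
    + by case: (x == u); rewrite ?h3 ?eqxx.
    + by rewrite (negPf hb); case: (x == b); rewrite ?h3 ?eqxx.
    + by rewrite (negPf ha); case: (x == a); rewrite ?h3 ?eqxx.
    + by rewrite (negPf ha) (negPf hb).
  - split=> //= x; rewrite ?h40 //.
    by rewrite /upd h30 // hu; case: (x == u).
move=> [e9 e10 e3 e4] x.
rewrite -[items_den _ _]/(item_den (Once (seqs [:: SConst 2 0; SSt 4 10 2])) (item_den _ s1)).
move: (item_den _ s1) e10 e4 => s2 e10 e4.
by rewrite /= /upd e10; case: (x == v) => //=; rewrite e4.
Qed.

Lemma leaves_v_spec st : (forall x, sA st 5 x = 0) ->
  forall x, x < sV st 0 -> (sA (items_den ph_leaves_v st) 5 x != 0) =
    [&& x != sV st 9, x != sV st 10 & sA st 4 x == 0].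
Proof.
move=> h5; set n := sV st 0.
pose J j s := [/\ sV s 9 = sV st 9, sV s 10 = sV st 10, sA s 4 = sA st 4 &
  forall x, (sA s 5 x != 0) = (x < j) && (sA st 4 x == 0)].
rewrite (_ : items_den _ _ = item_den (Once (seqs [:: SConst 2 0; SSt 5 9 2; SSt 5 10 2]))
  (loop_den n (seqs [:: SLd 2 4 1; SIf 2 SSkip (seqs [:: SConst 2 1; SSt 5 1 2])]) st)) //.
set lp := loop_den _ _ _; have : J n lp.
  apply: loop_ind; first by split=> // x; rewrite h5.
    move=> j s hj [h1 h2 h3 h4].
    rewrite /= h3; case: eqP => h; split=> //= x.
      rewrite /upd; case: (eqVneq x j) => [->|hn']; first by rewrite h ltnSn.
      by rewrite h4; congr (_ && _); lia.
    rewrite h4; case: (eqVneq x j) => [->|hn']; last by congr (_ && _); lia.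
    by move/eqP/negPf: h => ->; rewrite !andbF.
  by move=> s.
move: lp => s [g9 g10 g4 g5] x hx.
rewrite /= /upd g9 g10; case: (x == sV st 10); first by rewrite andbF.
by case: (x == sV st 9) => //=; rewrite g5 hx.
Qed.

(** * Cutting each colour into equal blocks along an order *)

Definition colour_count (r : nat -> nat) s i := count (fun y => r y == i) s.

(** If [p] vertices of the colour of [x] precede it, its block number is [p] divided by the block
    length [N / g]. Writing it as the quotient of [p * g] by [N] avoids computing that length: the
    machine keeps this quotient and the remainder for each colour. *)
Definition rank_label (r : nat -> nat) (N : nat -> nat) g s x :=
  (colour_count r (take (index x s) s) (r x) * g) %/ N (r x).

Lemma colour_count_rcons r s x i :
  colour_count r (rcons s x) i = colour_count r s i + (r x == i).
Proof. by rewrite /colour_count -cats1 count_cat /= addn0. Qed.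

Lemma rank_label_rcons r N g s x y : y \in s ->
  rank_label r N g (rcons s x) y = rank_label r N g s y.
Proof. by move=> hy; rewrite /rank_label -cats1 index_cat hy take_cat index_mem hy. Qed.

Lemma rank_label_last r N g s x : x \notin s ->
  rank_label r N g (rcons s x) x = (colour_count r s (r x) * g) %/ N (r x).
Proof.
by move=> hx; rewrite /rank_label -cats1 index_cat (negPf hx) /= eqxx addn0 take_size_cat.
Qed.

Definition assigned b r N g s st :=
  [/\ sA st 0 = r, sA st 1 = N, sV st 5 = g,
    forall i, sA st (fill_id b) i = (colour_count r s i * g) %% N i /\
      sA st (cur_id b) i = (colour_count r s i * g) %/ N i &
    forall x, x \in s -> sA st (lab_id b) x = rank_label r N g s x].

(** Remainder and modulus are both multiples of [g], so adding [g] to the remainder may reach [N]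
    but never jumps over it. *)
Lemma assign_step k g N : 0 < N -> g %| N -> 0 < g ->
  (k.+1 * g) %% N = (if N - ((k * g) %% N + g) == 0 then 0 else (k * g) %% N + g) /\
  (k.+1 * g) %/ N = (if N - ((k * g) %% N + g) == 0 then ((k * g) %/ N).+1 else (k * g) %/ N).
Proof.
move=> hN hg g0.
have hf : (k * g) %% N < N by rewrite ltn_mod.
have gf : g %| (k * g) %% N by rewrite /dvdn modn_dvdm // modnMl.
have e : k.+1 * g = (k * g) %/ N * N + ((k * g) %% N + g).
  by rewrite mulSn {1}(divn_eq (k * g) N); lia.
have hle : (k * g) %% N + g <= N.
  case/dvdnP: gf hf => a ->; case/dvdnP: hg => b ->.
  by rewrite ltn_pmul2r // -mulSnr leq_pmul2r.
rewrite !e; move: hle; move: ((k * g) %% N + g) => f hle.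
rewrite modnMDl divnMDl //; case: eqP => h.
  have -> : f = N by lia.
  by rewrite modnn divnn hN addn1.
have hf2 : f < N by lia.
by rewrite (modn_small hf2) (divn_small hf2) addn0.
Qed.

Lemma assign_spec b xv r N g s st :
  xv \in [:: 1; 9; 10] -> 0 < g -> 0 < N (r (sV st xv)) -> g %| N (r (sV st xv)) ->
  sV st xv \notin s -> assigned b r N g s st ->
  assigned b r N g (rcons s (sV st xv)) (den (assign b xv) st).
Proof.
move=> hx g0 N0 gN hns [h0 h1 h5 hi hl].
have [ef eq] := @assign_step (colour_count r s (r (sV st xv))) _ _ N0 gN g0.
have [] := hi (r (sV st xv)).
set F := sA st (fill_id b) (r (sV st xv)); set Q := sA st (cur_id b) (r (sV st xv)) => hF hQ.
rewrite -hF -hQ in ef eq.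
(* Three source registers and two orders give six programs that differ only in cell numbers; [key]
   holds the common argument and leaves only evaluation to each. *)
have key st' : sA st' 0 = r -> sA st' 1 = N -> sV st' 5 = g ->
   sA st' (lab_id b) = upd (sA st (lab_id b)) (sV st xv) Q ->
   sA st' (fill_id b) = upd (sA st (fill_id b)) (r (sV st xv))
      (if N (r (sV st xv)) - (F + g) == 0 then 0 else F + g) ->
   (forall i, sA st' (cur_id b) i = upd (sA st (cur_id b)) (r (sV st xv))
      (if N (r (sV st xv)) - (F + g) == 0 then Q + 1 else Q) i) ->
   assigned b r N g (rcons s (sV st xv)) st'.
  move=> k0 k1 k5 kl kf kc; split=> //.
    move=> i; rewrite kf kc colour_count_rcons /upd [i == _]eq_sym.
    by case: eqP => [<-|_]; rewrite ?addn1 ?ef ?eq // addn0; apply: hi.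
  move=> x; rewrite mem_rcons in_cons kl /upd; case: (eqVneq x (sV st xv)) => [->|hne] /=.
    by rewrite rank_label_last.
  by move=> hxs; rewrite hl // rank_label_rcons.
apply: key; clear hi hl ef eq hF hQ; move: hx @F @Q; rewrite !inE => /or3P[] /eqP->; case: b => /=;
  rewrite ?h0 ?h1 ?h5; case: ifP => //= _ i.
all: by rewrite /upd; case: eqP => // ->.
Qed.

Lemma assign_loop_spec b a r N g n s st :
  sV st 0 = n -> a \in [:: 4; 5] -> 0 < g ->
  (forall x, x < n -> 0 < N (r x) /\ g %| N (r x)) ->
  (forall x, x \in s -> x < n -> sA st a x = 0) ->
  assigned b r N g s st ->
  let st' := item_den (assign_loop b a) st in
  assigned b r N g (s ++ [seq x <- iota 0 n | sA st a x != 0]) st'.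
Proof.
move=> hn ha g0 hN hs h; rewrite /= hn.
set body := SSeq _ _.
pose I j s' := sA s' a = sA st a /\
  assigned b r N g (s ++ [seq x <- iota 0 j | sA st a x != 0]) s'.
have [] // : I n (loop_den n body st).
apply: loop_ind; first by rewrite /I cats0.
  move=> j s' hj [h1 h2].
  rewrite /I -[j.+1]addn1 iotaD filter_cat catA add0n [filter _ (iota j 1)]/=.
  rewrite /body [den _ _]/=.
  have ha1 : (Nat.eqb a a) by rewrite PeanoNat.Nat.eqb_refl.
  rewrite h1; case: eqP => hz /=; first by rewrite cats0.
  have [N0 gN] := hN _ hj.
  split; last first.
    rewrite cats1; apply: (@assign_spec b 1 r N g _ (setV (setV s' 1 j) 2 (sA st a j))) => //=.
    rewrite mem_cat mem_filter mem_iota ltnn !andbF orbF.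
    by apply/negP => /hs /(_ hj).
  rewrite -[LHS]/(sA (den (assign b 1) (setV (setV s' 1 j) 2 (sA st a j))) a) den_frameA //.
  by move: ha; rewrite !inE => /orP[] /eqP->; clear; case: b.
by move=> s' [h1 h2].
Qed.

Lemma assigned_nil b r N g st : sA st 0 = r -> sA st 1 = N -> sV st 5 = g ->
  (forall i, sA st (fill_id b) i = 0) -> (forall i, sA st (cur_id b) i = 0) ->
  assigned b r N g [::] st.
Proof. by move=> h0 h1 h5 hf hc; split=> // i; rewrite hf hc mul0n mod0n div0n. Qed.

Definition marked (A : nat -> nat) n := [seq x <- iota 0 n | A x != 0].

Lemma mem_marked A n x : (x \in marked A n) = (A x != 0) && (x < n).
Proof. by rewrite mem_filter mem_iota. Qed.

Section AssignPhases.
Variables (r N A4 A5 : nat -> nat) (n g u v : nat) (st : state).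
Hypotheses (hn : sV st 0 = n) (hu : sV st 9 = u) (hv : sV st 10 = v).
Hypotheses (h4 : sA st 4 = A4) (h5 : sA st 5 = A5).
Hypotheses (g0 : 0 < g) (hN : forall x, x < n -> 0 < N (r x) /\ g %| N (r x)).
Hypotheses (ltun : u < n) (ltvn : v < n) (neuv : u != v).
Hypotheses (u4 : A4 u = 0) (u5 : A5 u = 0) (v4 : A4 v = 0) (v5 : A5 v = 0).
Hypothesis disj : forall x, A4 x != 0 -> A5 x = 0.

Lemma assign_split_spec : assigned true r N g [::] st ->
  assigned true r N g (u :: marked A4 n ++ rcons (marked A5 n) v) (items_den ph_split st).
Proof.
move=> h0; have [Nu gu] := hN ltun; have [Nv gv] := hN ltvn.
have h1 : assigned true r N g [:: u] (item_den (Once (assign true 9)) st).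
  by rewrite -hu in Nu gu *; apply: (@assign_spec true 9 r N g [::]).
pose s1 := item_den (Once (assign true 9)) st.
pose s2 := item_den (assign_loop true 4) s1.
pose s3 := item_den (assign_loop true 5) s2.
have f1 x : x \in [:: 0; 9; 10] -> sV s1 x = sV st x.
  by rewrite !inE => /or3P[] /eqP->; apply: item_frameV.
have f2 x : x \in [:: 0; 9; 10] -> sV s2 x = sV s1 x.
  by rewrite !inE => /or3P[] /eqP->; apply: item_frameV.
have f3 x : x \in [:: 0; 9; 10] -> sV s3 x = sV s2 x.
  by rewrite !inE => /or3P[] /eqP->; apply: item_frameV.
have a1 x : x \in [:: 4; 5] -> sA s1 x = sA st x.
  by rewrite !inE => /orP[] /eqP->; apply: item_frameA.
have a2 x : x \in [:: 4; 5] -> sA s2 x = sA s1 x.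
  by rewrite !inE => /orP[] /eqP->; apply: item_frameA.
have h2 : assigned true r N g ([:: u] ++ marked A4 n) s2.
  rewrite /marked -h4 -a1 //; apply: assign_loop_spec => //; first by rewrite f1.
  by move=> x; rewrite inE => /eqP->; rewrite a1 // h4.
have h3 : assigned true r N g (([:: u] ++ marked A4 n) ++ marked A5 n) s3.
  rewrite /marked -h5 -a1 // -a2 //; apply: assign_loop_spec => //; first by rewrite f2 // f1.
  move=> x; rewrite mem_cat inE mem_filter a2 // a1 // h5.
  by case/orP => [/eqP->|/andP[hx _]] _ //; apply: disj.
have e10 : sV s3 10 = v by rewrite f3 // f2 // f1.
rewrite -[_ :: _]/([:: u] ++ marked A4 n ++ rcons (marked A5 n) v) -!rcons_cat catA.
rewrite -[items_den _ _]/(den (assign true 10) s3).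
have := @assign_spec true 10 r N g ([:: u] ++ marked A4 n ++ marked A5 n) s3 erefl g0.
rewrite e10 catA; apply=> //.
by rewrite !mem_cat inE !mem_filter v4 v5 eq_sym (negPf neuv).
Qed.

Lemma assign_merge_spec : assigned false r N g [::] st ->
  assigned false r N g (u :: v :: marked A4 n ++ marked A5 n) (items_den ph_merge st).
Proof.
move=> h0; have [Nu gu] := hN ltun; have [Nv gv] := hN ltvn.
pose s1 := item_den (Once (assign false 9)) st.
have h1 : assigned false r N g [:: u] s1.
  by rewrite -hu in Nu gu *; apply: (@assign_spec false 9 r N g [::]).
pose s2 := item_den (Once (assign false 10)) s1.
pose s3 := item_den (assign_loop false 4) s2.
have f1 x : x \in [:: 0; 9; 10] -> sV s1 x = sV st x.
  by rewrite !inE => /or3P[] /eqP->; apply: item_frameV.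
have f2 x : x \in [:: 0; 9; 10] -> sV s2 x = sV s1 x.
  by rewrite !inE => /or3P[] /eqP->; apply: item_frameV.
have f3 x : x \in [:: 0; 9; 10] -> sV s3 x = sV s2 x.
  by rewrite !inE => /or3P[] /eqP->; apply: item_frameV.
have a1 x : x \in [:: 4; 5] -> sA s1 x = sA st x.
  by rewrite !inE => /orP[] /eqP->; apply: item_frameA.
have a2 x : x \in [:: 4; 5] -> sA s2 x = sA s1 x.
  by rewrite !inE => /orP[] /eqP->; apply: item_frameA.
have a3 x : x \in [:: 4; 5] -> sA s3 x = sA s2 x.
  by rewrite !inE => /orP[] /eqP->; apply: item_frameA.
have h2 : assigned false r N g [:: u; v] s2.
  have e10 : sV s1 10 = v by rewrite f1.
  have := @assign_spec false 10 r N g [:: u] s1 erefl g0; rewrite e10; apply=> //.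
  by rewrite inE eq_sym.
have h3 : assigned false r N g ([:: u; v] ++ marked A4 n) s3.
  rewrite /marked -h4 -a1 // -a2 //; apply: assign_loop_spec => //; first by rewrite f2 // f1.
  by move=> x; rewrite !inE => /orP[] /eqP->; rewrite a2 // a1 // h4.
rewrite -[_ :: _]/([:: u; v] ++ marked A4 n ++ marked A5 n) catA.
rewrite /marked -h5 -a1 // -a2 // -a3 //; apply: assign_loop_spec => //.
  by rewrite f3 // f2 // f1.
move=> x; rewrite mem_cat !inE mem_filter a3 // a2 // a1 // h5.
by case/orP => [/orP[]/eqP->|/andP[hx _]] _ //; apply: disj.
Qed.
End AssignPhases.

Lemma compare_spec b k st : k \in [:: 8; 11] -> sV (den (compare b k) st) k =
  sV st k + (sA st (lab_id b) (sV st 3) == sA st (lab_id b) (sV st 4)).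
Proof.
have cmp x y : (x - y + (y - x) == 0) = (x == y) by lia.
rewrite !inE => /orP[] /eqP->; rewrite /compare /= cmp; case: ifP => h /=;
  by rewrite ?addn0.
Qed.

Lemma score_spec n r L st : 0 < n -> sV st 0 = n -> sA st 0 = r -> raw_edges n r L ->
  sV (items_den ph_score st) 8 = count (fun p => sA st 8 p.1 == sA st 8 p.2) L /\
  sV (items_den ph_score st) 11 = count (fun p => sA st 11 p.1 == sA st 11 p.2) L.
Proof.
move=> n0 hn hr hL.
pose I (l : seq (nat * nat)) s := [/\ sA s 8 = sA st 8, sA s 11 = sA st 11,
  sV s 8 = count (fun p => sA st 8 p.1 == sA st 8 p.2) l &
  sV s 11 = count (fun p => sA st 11 p.1 == sA st 11 p.2) l].
have [] // : I L (items_den ph_score st).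
apply: (@edge_loop I _ n r L) => //.
  by move=> l s [|[|[|[|[|x]]]]] w.
move=> l [a b] s _ e0 e3 e4 [h1 h2 h3 h4]; rewrite /= in e3 e4.
rewrite -[den _ _]/(den (compare false 11) (den (compare true 8) s)).
have fA x s' b' k : sA (den (compare b' k) s') x = sA s' x by apply: den_frameA.
split; rewrite ?fA //; rewrite -cats1 count_cat.
  by rewrite den_frameV // compare_spec // h3 /= h1 e3 e4 addn0.
by rewrite compare_spec // !den_frameV // fA h4 /= h2 e3 e4 addn0.
Qed.

Lemma pick_leaves_spec st : let n := sV st 0 in let v := sV st 10 in
  sV (items_den ph_pick st) 12 = last v (marked (sA st 4) n) /\
  sV (items_den ph_pick st) 13 = last v (marked (sA st 5) n).
Proof.
move=> n v.
pose I j s := [/\ sA s 4 = sA st 4, sA s 5 = sA st 5,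
  sV s 12 = last v (marked (sA st 4) j) & sV s 13 = last v (marked (sA st 5) j)].
have [] // : I n (items_den ph_pick st).
apply: loop_ind => //.
  by split=> //=; rewrite addn0.
move=> j s hj [h1 h2 h3 h4].
have e A : marked A j.+1 = if A j == 0 then marked A j else rcons (marked A j) j.
  rewrite /marked -[j.+1]addn1 iotaD filter_cat /=; case: (A j == 0) => /=.
    by rewrite cats0.
  by rewrite cats1.
rewrite /I !e /= h1; case: (sA st 4 j == 0) => /=; rewrite h2; case: (sA st 5 j == 0) => /=;
  by split=> //=; rewrite ?last_rcons ?addn0.
Qed.

Lemma out_spec st x : x < sV st 0 ->
  sA (items_den ph_out st) 12 x =
  if sV st 0 - sV st 5 == 0 then
    if x == sV st 10 then sV st 13 else if x == sV st 9 then sV st 12 else x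
  else if sV st 8 - sV st 11 == 0 then sA st 11 x else sA st 8 x.
Proof.
move: x; set n := sV st 0.
pose J j s := [/\ forall x, x \in [:: 0; 5; 8; 9; 10; 11; 12; 13] -> sV s x = sV st x,
  sA s 8 = sA st 8, sA s 11 = sA st 11 &
  forall x, x < j -> sA s 12 x = if n - sV st 5 == 0 then x else
    if sV st 8 - sV st 11 == 0 then sA st 11 x else sA st 8 x].
set body := seqs [:: SSub 2 0 5;
  SIf 2 (seqs [:: SSub 3 8 11; SIf 3 (SLd 4 8 1) (SLd 4 11 1); SSt 12 1 4]) (SSt 12 1 1)].
rewrite (_ : items_den _ _ = item_den (Once (SSeq (SSub 2 0 5) (SIf 2 SSkip
  (SSeq (SSt 12 9 12) (SSt 12 10 13))))) (loop_den n body st)) //.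
set lp := loop_den _ _ _; have : J n lp.
  apply: loop_ind => // [j s hj [h1 h2 h3 h4]|s [h1 h2 h3 h4]]; last first.
    split=> //= x; rewrite !inE => hx; rewrite -h1 ?inE //.
    by case: x hx => [|[|x]].
  have e x : x \in [:: 0; 5; 8; 9; 10; 11; 12; 13] ->
      sV (den body (setV s 1 j)) x = sV st x.
    by move=> hx; rewrite -h1 // den_frameV; move: hx; rewrite !inE;
      do 7 (case/orP => [/eqP->//|]); move/eqP->.
  split=> //; [by rewrite den_frameA|by rewrite den_frameA|] => x hx.
  rewrite /body /= !h1 // -/n; case: ifP => h /=.
    rewrite /upd; case: (eqVneq x j) => [->//|hne]; rewrite h4 ?h //; lia.
  rewrite ?h1 // ?h2 ?h3; case: (sV st 8 - _ == 0) h4 => h4 /=;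
    by rewrite /upd; case: (eqVneq x j) => [->//|hne]; rewrite h4 ?h //; lia.
move: lp => s [g1 g2 g3 g4] x hx.
by rewrite /= !g1 // -/n; case: ifP => h /=; rewrite ?g1 // /upd ?g1 //= g4 // h.
Qed.

Definition final_label n g u v Lu Lv L (lS lM : nat -> nat) x :=
  if n - g == 0 then if x == v then last v Lv else if x == u then last v Lu else x
  else if count (fun p : nat * nat => lS p.1 == lS p.2) L -
          count (fun p : nat * nat => lM p.1 == lM p.2) L == 0
  then lM x else lS x.

Lemma sum_colour_count r n s : all (fun x => r x < n) s ->
  \sum_(0 <= i < n) colour_count r s i = size s.
Proof.
elim: s => [|x s IH] /=; first by rewrite big1.
move=> /andP[hx hs]; rewrite big_split /= IH // (bigD1_seq (r x)) /= ?iota_uniq //; last first.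
  by rewrite mem_index_iota.
rewrite eqxx big1 ?addn0 ?add1n // => i hi.
by rewrite eq_sym (negPf hi).
Qed.

(* The intermediate state is abstracted, so that conversion never evaluates the program. *)
Lemma items_den_abs its st : {st' | [/\ st' = items_den its st,
  forall x, ~~ has (item_writesV x) its -> sV st' x = sV st x &
  forall a, ~~ has (item_writesA a) its -> sA st' a = sA st a]}.
Proof.
exists (items_den its st); split=> // x; [exact: items_frameV|exact: items_frameA].
Qed.

(** This interface mentions numbers and the edge list only, no graph: whatever listed edge passes
    the degree test becomes [u], [v], in the orientation of the list. *)
Lemma main_spec n r L st :
  0 < n -> sV st 0 = n -> sA st = (fun a i => if a == 0 then r i else 0) -> raw_edges n r L ->
  (forall x, x < n -> r x < n) ->
  (forall p, p \in L -> [/\ p.1 < n, p.2 < n & p.1 != p.2]) ->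
  let N := colour_count r (iota 0 n) in
  let D x := \sum_(p <- L) ((p.1 == x) + (p.2 == x)) in
  has (fun p => n <= D p.1 + D p.2) L ->
  exists u v g, [/\ (u, v) \in L, n <= D u + D v, 0 < g,
    forall q, q %| g <-> (q %| n /\ forall i, q %| N i) &
    forall Lu Lv x,
      Lu = [seq x <- iota 0 n | (x != v) && (((u, x) \in L) || ((x, u) \in L))] ->
      Lv = [seq x <- iota 0 n | [&& x != u, x != v & x \notin Lu]] -> x < n ->
      sA (items_den main_items st) 12 x = final_label n g u v Lu Lv L
        (rank_label r N g (u :: Lu ++ rcons Lv v)) (rank_label r N g (u :: v :: Lu ++ Lv)) x].
Proof.
move=> n0 hn hA hL hr hE N D hD.
rewrite /main_items !items_den_cat.
have [s1 [E1 FV1 FA1]] := items_den_abs ph_count st; rewrite -E1.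
have [s2 [E2 FV2 FA2]] := items_den_abs ph_gcd s1; rewrite -E2.
have [s3 [E3 FV3 FA3]] := items_den_abs ph_degree s2; rewrite -E3.
have [s4 [E4 FV4 FA4]] := items_den_abs ph_center s3; rewrite -E4.
have [s5 [E5 FV5 FA5]] := items_den_abs ph_leaves_u s4; rewrite -E5.
have [s6 [E6 FV6 FA6]] := items_den_abs ph_leaves_v s5; rewrite -E6.
have [s7 [E7 FV7 FA7]] := items_den_abs ph_split s6; rewrite -E7.
have [s8 [E8 FV8 FA8]] := items_den_abs ph_merge s7; rewrite -E8.
have [s9 [E9 FV9 FA9]] := items_den_abs ph_score s8; rewrite -E9.
have [s10 [E10 FV10 FA10]] := items_den_abs ph_pick s9; rewrite -E10.
have z a : a != 0 -> forall x, sA st a x = 0 by move=> /negPf ha x; rewrite hA ha.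
have r0 : sA st 0 = r by rewrite hA.
have V1 : sV s1 0 = n by rewrite FV1.
have V2 : sV s2 0 = n by rewrite FV2.
have V3 : sV s3 0 = n by rewrite FV3.
have V4 : sV s4 0 = n by rewrite FV4.
have V5 : sV s5 0 = n by rewrite FV5.
have V6 : sV s6 0 = n by rewrite FV6.
have V7 : sV s7 0 = n by rewrite FV7.
have V8 : sV s8 0 = n by rewrite FV8.
have V9 : sV s9 0 = n by rewrite FV9.
have V10 : sV s10 0 = n by rewrite FV10.
have r1 : sA s1 0 = r by rewrite FA1.
have r2 : sA s2 0 = r by rewrite FA2.
have r3 : sA s3 0 = r by rewrite FA3.
have r4 : sA s4 0 = r by rewrite FA4.
have r5 : sA s5 0 = r by rewrite FA5.
have r6 : sA s6 0 = r by rewrite FA6.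
have r7 : sA s7 0 = r by rewrite FA7.
have r8 : sA s8 0 = r by rewrite FA8.
have N1 i : sA s1 1 i = N i by rewrite E1 count_spec ?hn ?r0 // => j; apply: z.
have Nz i : n <= i -> N i = 0.
  move=> hi; apply/eqP; rewrite -leqn0 leqNgt -has_count; apply/hasPn => x.
  by rewrite mem_iota => /andP[_ /hr hx]; rewrite neq_ltn (leq_trans hx hi).
have [] := @gcd_spec s1; rewrite ?V1 //; first by move=> i hi; rewrite N1 Nz.
  under eq_bigr do rewrite N1.
  rewrite sum_colour_count ?size_iota //; apply/allP => x.
  by rewrite mem_iota => /andP[_ /hr].
rewrite -E2; have [g Eg] : {g | g = sV s2 5} by exists (sV s2 5).
rewrite -Eg => g0 hg.
have D3 x : sA s3 2 x = D x.
  rewrite E3 (@degree_spec n r L s2) // => y.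
  by rewrite FA2 // FA1 // z.
have [u Eu] : {u | u = sV s4 9} by exists (sV s4 9).
have [v Ev] : {v | v = sV s4 10} by exists (sV s4 10).
have [_] := @center_spec n r L s3 (sA s3 2) n0 V3 r3 hL erefl; rewrite -E4 -Eu -Ev => hc.
have {hc} : (u, v) \in [seq p <- L | n <= D p.1 + D p.2].
  have -> : [seq p <- L | n <= D p.1 + D p.2] = [seq p <- L | n <= sA s3 2 p.1 + sA s3 2 p.2].
    by apply: eq_filter => p; rewrite !D3.
  by apply: hc; rewrite (eq_has (a2 := fun p => n <= D p.1 + D p.2)) // => p; rewrite !D3.
rewrite mem_filter => /andP[huvD huv].
exists u, v, g; split=> //.
  by move=> q; rewrite hg; split=> -[h1 h2]; split=> // i; move: (h2 i); rewrite N1.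
move=> Lu Lv x0 eLu eLv hx0.
have [ltun ltvn neuv] := hE _ huv; rewrite /= in ltun ltvn neuv.
have A5' x : (sA s5 4 x != 0) = [&& x != v & ((u, x) \in L) || ((x, u) \in L)].
  by rewrite E5; apply: (@leaves_u_spec n r L s4 u v) => // y;
    rewrite FA4 // FA3 // FA2 // FA1 // z.
have A6' x : x < n -> (sA s6 5 x != 0) = [&& x != u, x != v & sA s5 4 x == 0].
  move=> hx; rewrite E6 leaves_v_spec ?V5 //; first by rewrite !FV5 // Eu Ev.
  by move=> y; rewrite FA5 // FA4 // FA3 // FA2 // FA1 // z.
have e64 : sA s6 4 = sA s5 4 by rewrite FA6.
have mLu : marked (sA s6 4) n = Lu by rewrite eLu; apply: eq_filter => y; rewrite e64 A5'.
have mLv : marked (sA s6 5) n = Lv.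
  rewrite eLv; apply: eq_in_filter => y; rewrite mem_iota => /andP[_ hy]; rewrite A6' //.
  by rewrite -mLu mem_marked hy andbT e64 negbK.
have nu : ((u, u) \in L) = false by apply/negP => /hE[_ _]; rewrite eqxx.
have hN x : x < n -> 0 < sA s1 1 (r x) /\ g %| sA s1 1 (r x).
  move=> hx; split; last by have /hg[] := dvdnn g.
  by rewrite N1 -has_count; apply/hasP; exists x => //; rewrite mem_iota.
have u0 : sA s6 4 u = 0 by apply/eqP; rewrite -[_ == _]negbK e64 A5' nu !andbF.
have v0 : sA s6 4 v = 0 by apply/eqP; rewrite -[_ == _]negbK e64 A5' eqxx.
have u5 : sA s6 5 u = 0 by apply/eqP; rewrite -[_ == _]negbK A6' // eqxx.
have v5 : sA s6 5 v = 0 by apply/eqP; rewrite -[_ == _]negbK A6' // eqxx andbF.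
have disj y : sA s6 4 y != 0 -> sA s6 5 y = 0.
  rewrite e64; case: (ltnP y n) => hy h; apply/eqP; rewrite -[_ == _]negbK.
    by rewrite A6' // (negPf h) !andbF.
  by move: h; rewrite A5' => /andP[_ /orP[]/hE[/= h1 h2 _]]; lia.
have z6 a i : a \in [:: 6; 7; 9; 10] -> sA s6 a i = 0.
  by rewrite !inE => /or4P[] /eqP->; rewrite FA6 // FA5 // FA4 // FA3 // FA2 // FA1 // z.
have g6 : sV s6 5 = g by rewrite FV6 // FV5 // FV4 // FV3.
have N6 : sA s6 1 = sA s1 1 by rewrite FA6 // FA5 // FA4 // FA3 // FA2.
have u6 : sV s6 9 = u by rewrite FV6 // FV5.
have v6 : sV s6 10 = v by rewrite FV6 // FV5.
have [_ _ _ _ l7] := @assign_split_spec r (sA s1 1) (sA s6 4) (sA s6 5) n g u v s6 V6 u6 v6 erefl erefl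
  g0 hN ltun ltvn neuv u0 u5 v0 v5 disj
  (@assigned_nil true _ _ _ _ r6 N6 g6 (fun i => z6 6 i erefl) (fun i => z6 7 i erefl)).
have e74 : sA s7 4 = sA s6 4 by rewrite FA7.
have e75 : sA s7 5 = sA s6 5 by rewrite FA7.
have u7 : sV s7 9 = u by rewrite FV7.
have v7 : sV s7 10 = v by rewrite FV7.
have g7 : sV s7 5 = g by rewrite FV7.
have N7 : sA s7 1 = sA s1 1 by rewrite FA7.
have z7 a i : a \in [:: 9; 10] -> sA s7 a i = 0.
  by rewrite !inE => /orP[] /eqP->; rewrite FA7 // z6.
have [_ _ _ _ l8] := @assign_merge_spec r (sA s1 1) (sA s6 4) (sA s6 5) n g u v s7 V7 u7 v7 e74 e75
  g0 hN ltun ltvn neuv u0 u5 v0 v5 disj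
  (@assigned_nil false _ _ _ _ r7 N7 g7 (fun i => z7 9 i erefl) (fun i => z7 10 i erefl)).
rewrite -E7 -[lab_id _]/8 mLu mLv in l7; rewrite -E8 -[lab_id _]/11 mLu mLv in l8.
have inLu y : y < n -> y \in Lu = (sA s6 4 y != 0) by move=> hy; rewrite -mLu mem_marked hy andbT.
have inLv y : y < n -> y \in Lv = (sA s6 5 y != 0) by move=> hy; rewrite -mLv mem_marked hy andbT.
have cov y : y < n -> [|| y == u, y == v, y \in Lu | y \in Lv].
  move=> hy; rewrite inLu // inLv // A6' // e64.
  by case: (y == u) (y == v) (sA s5 4 y == 0) => [] [] [].
pose lS := rank_label r N g (u :: Lu ++ rcons Lv v).
pose lM := rank_label r N g (u :: v :: Lu ++ Lv).
have rl s y : rank_label r (sA s1 1) g s y = rank_label r N g s y.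
  by rewrite /rank_label N1.
have eS y : y < n -> sA s8 8 y = lS y.
  move=> hy; rewrite FA8 // l7 ?rl // !inE mem_cat mem_rcons inE.
  by case/or4P: (cov _ hy) => ->; rewrite ?orbT.
have eM y : y < n -> sA s8 11 y = lM y.
  move=> hy; rewrite l8 ?rl // !inE mem_cat.
  by case/or4P: (cov _ hy) => ->; rewrite ?orbT.
have [c8 c11] := @score_spec n r L s8 n0 V8 r8 hL; rewrite -E9 in c8 c11.
have [p12 p13] := pick_leaves_spec s9; rewrite -E10 V9 in p12 p13.
rewrite out_spec V10 // /final_label.
have -> : sV s10 5 = g by rewrite FV10 // FV9 // FV8.
have -> : sV s10 9 = u by rewrite FV10 // FV9 // FV8.
have -> : sV s10 10 = v by rewrite FV10 // FV9 // FV8.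
rewrite p12 p13 !FA9 // (FA8 4) // (FA8 5) // e74 e75 mLu mLv FV9 // FV8 // v7.
rewrite FV10 // (FV10 11) // c8 c11.
have -> : sA s10 8 x0 = lS x0 by rewrite FA10 // FA9 // eS.
have -> : sA s10 11 x0 = lM x0 by rewrite FA10 // FA9 // eM.
have -> : count (fun p => sA s8 8 p.1 == sA s8 8 p.2) L = count (fun p => lS p.1 == lS p.2) L.
  by apply: eq_in_count => p /hE[h1 h2 _]; rewrite !eS.
have -> // : count (fun p => sA s8 11 p.1 == sA s8 11 p.2) L = count (fun p => lM p.1 == lM p.2) L.
by apply: eq_in_count => p /hE[h1 h2 _]; rewrite !eM.
Qed.

(** * Trees of diameter at most 3 *)

Section Tree.
Variables (n : nat) (e : rel 'I_n).
Hypotheses (esym : symmetric e) (eirr : irreflexive e) (eacyc : acyclic_graph e).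

Fixpoint nonbacktracking (s : seq 'I_n) := match s with
  | x :: ((_ :: z :: _) as t) => (x != z) && nonbacktracking t
  | _ => true
  end.

Lemma nonbacktracking_cons x y s : nonbacktracking (x :: y :: s) =
  (if s is z :: _ then x != z else true) && nonbacktracking (y :: s).
Proof. by case: s. Qed.

(** If the head recurs in the tail, which is simple by induction, the stretch up to the recurrence
    closes a cycle; the ban on backtracking gives it at least three vertices. *)
Lemma nonbacktracking_uniq s : sorted e s -> nonbacktracking s -> uniq s.
Proof.
elim: s => // x [|y s] // IH hs hb.
rewrite nonbacktracking_cons in hb; case/andP: hb => hz hb.
have /andP[exy hys] : e x y && path e y s := hs.
have hu := IH hys hb; rewrite cons_uniq hu andbT; apply/negP.
rewrite inE => /orP[/eqP exy'|]; first by rewrite exy' eirr in exy.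
move=> hx; case/splitPr: hx hz hu hys {IH hb hs} => s1 s2 hz hu hys.
apply: (eacyc (x := x) (s := y :: s1)).
move: hys; rewrite cat_path => /andP[h1 /andP[h2 _]].
move: hu; rewrite -cat_cons cat_uniq => /and3P[u1 /norP[u2 _] _]; split.
- by rewrite cons_uniq u1 andbT.
- by case: s1 hz {u1 u2 h1 h2} => //=; rewrite eqxx.
- by rewrite /= exy.
- exact: h2.
Qed.

Lemma uniq_nonbacktracking s : uniq s -> nonbacktracking s.
Proof.
elim: s => // x [|y s] // IH /andP[hx hu].
rewrite nonbacktracking_cons IH // andbT; case: s hx {IH hu} => // z s.
by rewrite !inE !negb_or => /and3P[].
Qed.

Lemma nonbacktracking_catrev p x q : uniq (x :: p) -> nonbacktracking (x :: q) ->
  (if p is a :: _ then if q is b :: _ then a != b else true else true) ->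
  nonbacktracking (catrev p (x :: q)).
Proof.
elim: p x q => // a p IH x q; rewrite !cons_uniq => /andP[hx /andP[ha hu]] hq hab.
move: hx; rewrite inE negb_or => /andP[hxa hxp].
apply: (IH a (x :: q)); first by rewrite /= ha.
  by rewrite nonbacktracking_cons hq andbT; case: q hab {hq}.
by case: p hxp {ha hu IH} => // b p; rewrite inE negb_or eq_sym => /andP[].
Qed.

Lemma sorted_catrev p x q : path e x p -> path e x q -> sorted e (catrev p (x :: q)).
Proof.
elim: p x q => //= a p IH x q /andP[exa hp] hq; apply: IH => //=.
by rewrite esym exa.
Qed.

(** Where the paths first diverge, one reversed followed by the other is a nonbacktracking walk that
    meets the common endpoint twice. *)
Lemma unique_path x p q : path e x p -> path e x q -> uniq (x :: p) -> uniq (x :: q) ->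
  last x p = last x q -> p = q.
Proof.
elim: p x q => [|a p IH] x [|b q] //.
- by move=> _ _ _ /= /andP[hx _] h; move: (mem_last b q); rewrite -h (negPf hx).
- by move=> _ _ /= /andP[hx _] _ h; move: (mem_last a p); rewrite h (negPf hx).
move=> hp hq up uq hl; case: (a =P b) => [eab|/eqP hab].
  subst b; congr (_ :: _); move: hp hq up uq hl => /= /andP[_ hp] /andP[_ hq] /andP[_ up] /andP[_ uq].
  exact: IH.
have hs := sorted_catrev hp hq.
have hb := @nonbacktracking_catrev (a :: p) x (b :: q) up (uniq_nonbacktracking uq) hab.
have := nonbacktracking_uniq hs hb; rewrite catrevE cat_uniq => /and3P[_ /hasPn/(_ (last x (b :: q)))].
rewrite mem_last mem_rev -hl => /(_ erefl) h _.
by move: h; rewrite [last _ _]/= mem_last.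
Qed.

Hypotheses (econn : connected_graph e) (diam : diameter_le e 3).

(** The short walk given by the diameter contains a simple path, which by uniqueness is [p]. *)
Lemma size_simple_path x p : path e x p -> uniq (x :: p) -> size p <= 3.
Proof.
move=> hp up; have [s [hs [ps ls]]] := diam x (last x p).
case/shortenP: ps ls => q hq uq sub lq; rewrite (unique_path hp hq up uq) //.
by apply: leq_trans hs; apply: uniq_leq_size => //; case/andP: uq.
Qed.

Definition extends u v := [exists a, e a u && (a != v)].

Lemma edge_exists : 1 < n -> exists u v, e u v.
Proof.
move=> n1; have n0 : 0 < n by lia.
have [[|b s] [hs hl]] := econn (Ordinal n0) (Ordinal n1); first by move/(congr1 val): hl.
by exists (Ordinal n0), b; case/andP: hs.
Qed.

(** Prolonging the path backwards to [a] gives a simple path with [size p + 2] edges, of which at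
    most 3 are allowed. *)
Lemma extends_walk a u v p : e a u -> a != v -> path e u (v :: p) -> uniq (u :: v :: p) ->
  size p <= 1.
Proof.
move=> eau hav hp hu; have : uniq (a :: u :: v :: p).
  apply: nonbacktracking_uniq; first by rewrite /sorted /= eau.
  by rewrite nonbacktracking_cons hav uniq_nonbacktracking.
by move/(size_simple_path (p := u :: v :: p)) => /=; rewrite eau; apply.
Qed.

(** If some edge has further neighbours at both ends, prolonging paths backwards over it bounds
    their length. Otherwise the tree is a star, and an edge whose first end has a further neighbour,
    if there is one, dominates. *)
Lemma dominating_edge_exists : 1 < n -> exists u v, e u v /\
  forall x, [|| x == u, x == v, e u x | e v x].
Proof.
move=> n1.
have reach_u u x : exists p, [/\ path e u p, uniq (u :: p) & last u p = x].
  have [s [hs hl]] := econn u x; case/shortenP: hs hl => q hq uq _ <-.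
  by exists q.
have [/existsP[u /existsP[v /and3P[euv hu hv]]]|hno] :=
  boolP [exists u, exists v, [&& e u v, extends u v & extends v u]].
  exists u, v; split=> // x; have [[|y p] [hp hup <-]] := reach_u u x; first by rewrite eqxx.
  case: (y =P v) => [eyv|/eqP hyv].
    subst y; case/existsP: hu => a /andP[eau hav].
    have := extends_walk eau hav hp hup; case: p hp {hup} => [|z [|]] //= hp _.
      by rewrite eqxx orbT.
    by case/and3P: hp => _ -> _; rewrite !orbT.
  case/existsP: hv => b /andP[ebv hbu].
  have hvu : path e v (u :: y :: p) by rewrite /= esym euv.
  have huv : uniq (v :: u :: y :: p).
    apply: nonbacktracking_uniq => //.
    by rewrite nonbacktracking_cons eq_sym hyv uniq_nonbacktracking.
  have := extends_walk ebv hbu hvu huv; case: p hp {hup hvu huv} => // hp _.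
  by case/andP: hp => -> _; rewrite !orbT.
have hno' u v : e u v -> extends u v -> extends v u -> False.
  by move=> h1 h2 h3; case/negP: hno; apply/existsP; exists u; apply/existsP; exists v; rewrite h1 h2.
have [u [v [euv huv]]] : exists u v, e u v /\ (extends u v \/ forall a b, e a b -> ~~ extends a b).
  have [/existsP[u /existsP[v /andP[h1 h2]]]|h] := boolP [exists u, exists v, e u v && extends u v].
    by exists u, v; split; last left.
  have [u [v h1]] := edge_exists n1; exists u, v; split=> //; right=> a b hab.
  by apply/negP => hx; case/negP: h; apply/existsP; exists a; apply/existsP; exists b; rewrite hab.
exists u, v; split=> // x; have [[|y p] [hp hup <-]] := reach_u u x; first by rewrite eqxx.
case: (y =P v) => [eyv|/eqP hyv].
  subst y; case: huv => [/existsP[a /andP[eau hav]]|huv].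
    have := extends_walk eau hav hp hup; case: p hp {hup} => [|z [|]] //= hp _.
      by rewrite eqxx orbT.
    by case/and3P: hp => _ -> _; rewrite !orbT.
  case: p hp hup => [|z p] hp hup; first by rewrite /= eqxx orbT.
  have /negP[] : ~~ extends v u by apply: huv; rewrite esym.
  case/and3P: hp => _ evz _; apply/existsP; exists z; rewrite esym evz /=.
  by move: hup; rewrite cons_uniq !inE !negb_or [z == u]eq_sym => /andP[/and3P[_ ->]].
have /andP[euy hp'] : e u y && path e y p := hp.
have ext : extends u y by apply/existsP; exists v; rewrite esym euv eq_sym.
case: p hp hp' hup => [|z p] hp hp' hup; first by rewrite /= euy !orbT.
case: (hno' u y euy ext); apply/existsP; exists z; case/andP: hp' => eyz _.
rewrite esym eyz /=; move: hup; rewrite cons_uniq !inE !negb_or [z == u]eq_sym.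
by case/andP => /and3P[_ ->].
Qed.
End Tree.

(** * Double stars: vertices, edges and degrees around a dominating edge *)

Section DoubleStar.
Variables (n : nat) (e : rel 'I_n).
Hypotheses (esym : symmetric e) (eirr : irreflexive e) (eacyc : acyclic_graph e).

Lemma edge_neq x y : e x y -> x != y.
Proof. by apply: contraTneq => ->; rewrite eirr. Qed.

Lemma no_triangle x y z : e x y -> e y z -> e z x -> False.
Proof.
move=> h1 h2 h3; apply: (eacyc (x := x) (s := [:: y; z])).
by split; rewrite //= ?h1 ?h2 // !inE negb_or edge_neq // eq_sym edge_neq // edge_neq.
Qed.

Lemma no_four_cycle x y z w : x != z -> y != w ->
  e x y -> e y z -> e z w -> e w x -> False.
Proof.
move=> hxz hyw h1 h2 h3 h4; apply: (eacyc (x := x) (s := [:: y; z; w])).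
split; rewrite //= ?h1 ?h2 ?h3 // !inE !negb_or hxz hyw !edge_neq //.
by rewrite esym.
Qed.

Definition dominates u v := forall x, [|| x == u, x == v, e u x | e v x].

(** Any other neighbour of [x] would close a cycle of length 3 or 4 through [u]. *)
Lemma leaf_neighbour u v x y : e u v -> dominates u v -> e u x -> x != v ->
  e x y = (y == u).
Proof.
move=> euv hd eux hxv; apply/idP/eqP => [exy|->]; last by rewrite esym.
apply/eqP; apply: contraT => hyu; exfalso.
case/or4P: (hd y) => [|/eqP hy|euy|evy]; first by rewrite (negPf hyu).
- by subst y; apply: (no_triangle eux exy); rewrite esym.
- by apply: (no_triangle eux exy); rewrite esym.
- by apply: (no_four_cycle (x := u) (y := x) (z := y) (w := v)); rewrite // 1?eq_sym // esym.
Qed.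

Definition leaves u v := [set x | e u x && (x != v)].

Variables (u v : 'I_n).
Hypotheses (euv : e u v) (hd : dominates u v).

Lemma dominates_sym : dominates v u.
Proof. by move=> x; case/or4P: (hd x) => ->; rewrite ?orbT. Qed.

Lemma leaves_disjoint x : x \in leaves u v -> x \notin leaves v u.
Proof.
rewrite !inE => /andP[h1 h2]; apply/negP => /andP[h3 _].
by apply: (no_triangle h1 (y := x) (z := v)); rewrite esym.
Qed.

Lemma leaves_cover x : (x \in leaves v u) = [&& x != u, x != v & x \notin leaves u v].
Proof.
apply/idP/idP => [h|/and3P[h1 h2 h3]].
  have := h; rewrite inE => /andP[h1 ->] /=; rewrite eq_sym edge_neq //=.
  by apply/negP => /leaves_disjoint; rewrite h.
move: h3 (hd x); rewrite !inE h2 andbT (negPf h1) (negPf h2) => /negPf -> /= ->.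
by [].
Qed.

Lemma sum_double_star (G : 'I_n -> nat) :
  \sum_x G x = G u + G v + (\sum_(x in leaves u v) G x + \sum_(x in leaves v u) G x).
Proof.
rewrite (bigD1 u) //= (bigD1 v) /=; last by rewrite eq_sym edge_neq.
rewrite -addnA; congr (_ + (_ + _)).
rewrite (bigID (mem (leaves u v))) /=; congr (_ + _); apply: eq_bigl => x.
  rewrite inE; case: (eqVneq x u) => [->|_]; first by rewrite eirr.
  by rewrite /= andbA andbC andbA andbb andbC.
by rewrite leaves_cover andbA.
Qed.

Lemma card_double_star : n = (#|leaves u v| + #|leaves v u|).+2.
Proof.
by have := sum_double_star (fun=> 1); rewrite !sum1_card card_ord add2n.
Qed.

Lemma sum_edges (F : 'I_n -> 'I_n -> nat) : (forall x y, F x y = F y x) ->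
  \sum_x \sum_(y | e x y) F x y =
  (F u v + (\sum_(x in leaves u v) F u x + \sum_(x in leaves v u) F v x)).*2.
Proof.
move=> Fs; have evu : e v u by rewrite esym.
have nb w z : e w z -> \sum_(y | e w y) F w y = F w z + \sum_(y in leaves w z) F w y.
  by move=> ewz; rewrite (bigD1 z) //=; congr (_ + _); apply: eq_bigl => y; rewrite inE.
rewrite sum_double_star (nb u v) // (nb v u) //.
have nb1 w z : e w z -> dominates w z -> \sum_(x in leaves w z) \sum_(y | e x y) F x y =
    \sum_(x in leaves w z) F w x.
  move=> ewz hwz; apply: eq_bigr => x; rewrite inE => /andP[h1 h2].
  by rewrite (eq_bigl (pred1 w)) ?big_pred1_eq 1?Fs // => y; apply: leaf_neighbour h2.
rewrite (nb1 u v) // (nb1 v u) //; last exact: dominates_sym.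
rewrite (Fs v u) -addnn; lia.
Qed.

(** The two centres count each other and every leaf is counted once. This makes the degree test of
    the program succeed on a dominating edge. *)
Lemma degree_sum : \sum_y e u y + \sum_y e v y = n.
Proof.
apply: etrans (Logic.eq_sym card_double_star).
have nb w z : e w z -> \sum_y (e w y : nat) = (#|leaves w z|).+1.
  move=> ewz; rewrite (bigD1 z) //= ewz add1n; congr _.+1.
  rewrite -sum1_card big_mkcond [RHS]big_mkcond; apply: eq_bigr => y _.
  by rewrite inE andbC; case: (y != z) (e w y) => [] [].
by rewrite (nb _ _ euv) (nb v u) ?addSn ?addnS // esym.
Qed.
End DoubleStar.

Section EdgeList.
Variables (n : nat) (e : rel 'I_n) (L : seq (nat * nat)).
Hypotheses (esym : symmetric e) (eirr : irreflexive e) (hL : edge_list e L).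

(** Double counting: each adjacent ordered pair is joined by exactly one list entry, and each entry
    joins exactly two ordered pairs. *)
Lemma sum_edge_list (F : nat -> nat -> nat) : (forall x y, F x y = F y x) ->
  \sum_(x : 'I_n) \sum_(y | e x y) F x y = (\sum_(p <- L) F p.1 p.2).*2.
Proof.
move=> Fs; case: hL => hcount hmem.
pose joins (p : nat * nat) (q : 'I_n * 'I_n) :=
  (p == (val q.1, val q.2)) || (p == (val q.2, val q.1)).
rewrite pair_big_dep /=.
transitivity (\sum_(q : 'I_n * 'I_n | e q.1 q.2) \sum_(p <- L | joins p q) F q.1 q.2).
  by apply: eq_bigr => q hq; rewrite big_const_seq hcount //= addn0.
rewrite (exchange_big_dep predT) //= -addnn -big_split /=.
rewrite big_seq [RHS]big_seq; apply: eq_bigr => p /hmem[a [b [eab ->]]] /=.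
have nab : a != b by apply: contraTneq eab => ->; rewrite eirr.
rewrite (bigD1 (a, b)) /=; last by rewrite eab /joins eqxx.
rewrite (bigD1 (b, a)) /=; last first.
  by rewrite esym eab /joins eqxx orbT xpair_eqE negb_and eq_sym nab.
rewrite big1 ?addn0 1?[F b a]Fs // => -[x y] /= /andP[/andP[/andP[_ h] h1] h2].
move: h h1 h2; rewrite /joins /= !xpair_eqE !(inj_eq val_inj) /=.
by rewrite [a == x]eq_sym [b == y]eq_sym [a == y]eq_sym [b == x]eq_sym andbC;
  case: (x == a) (y == b) (x == b) (y == a) => [] [] [] [].
Qed.
End EdgeList.

(** * The cost of a clustering *)

Lemma sum_symmetric n (X : rel 'I_n) : symmetric X ->
  \sum_x \sum_y (X x y : nat) =
  (#|[set q : 'I_n * 'I_n | (q.1 < q.2) && X q.1 q.2]|).*2 + \sum_x X x x.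
Proof.
move=> Xs; rewrite pair_big /=.
transitivity (\sum_(q : 'I_n * 'I_n) (((q.1 < q.2) && X q.1 q.2 : nat) +
   (((q.2 < q.1) && X q.1 q.2 : nat) + ((q.1 == q.2) && X q.1 q.2 : nat)))).
  apply: eq_bigr => -[x y] _ /=; rewrite -val_eqE /=.
  by case: ltngtP => /=; rewrite ?addn0.
rewrite !big_split /= -addnn -addnA -sum1_card; congr (_ + (_ + _)).
- by rewrite [RHS]big_mkcond; apply: eq_bigr => q _; rewrite inE.
- rewrite [RHS]big_mkcond (reindex_inj (h := fun q : 'I_n * 'I_n => (q.2, q.1))) /=; last first.
    by move=> [a b] [a' b'] [-> ->].
  by apply: eq_bigr => -[x y] _; rewrite inE /= Xs.
- rewrite -(pair_bigA _ (fun x y => (x == y) && X x y : nat)) /=; apply: eq_bigr => x _.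
  by rewrite (bigD1 x) //= eqxx big1 ?addn0 // => y /negPf; rewrite eq_sym => ->.
Qed.

Section Cost.
Variables (n : nat) (e : rel 'I_n).
Hypotheses (esym : symmetric e) (eirr : irreflexive e) (eacyc : acyclic_graph e).
Variables (u v : 'I_n).
Hypotheses (euv : e u v) (hd : dominates e u v).

(** The number of edges inside clusters, spelled out along the double star. *)
Definition internal (T : eqType) (f : 'I_n -> T) : nat :=
  (f u == f v) + (\sum_(x in leaves e u v) (f u == f x) + \sum_(x in leaves e v u) (f v == f x)).

Definition cluster (T : eqType) (f : 'I_n -> T) x := [set y | f y == f x].

(** For each ordered pair, the disagreement plus twice the indicator of an internal edge equals the
    indicator of a common cluster plus that of an edge. In the sum, the diagonal adds [n] to twice
    the cost, and the edges contribute [2 (n - 1)]. *)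
Lemma cost_formula (P : {set {set 'I_n}}) (T : eqType) (f : 'I_n -> T) :
  (forall x y, same_cluster P x y = (f x == f y)) ->
  (cost e P).*2 + 4 * internal f + 2 = \sum_x #|cluster f x| + n.
Proof.
move=> hf.
pose X x y := (~~ e x y && (f x == f y)) || (e x y && ~~ (f x == f y)).
have Xs : symmetric X by move=> x y; rewrite /X esym eq_sym.
have hX := sum_symmetric Xs.
have e1 : \sum_x X x x = n.
  by rewrite -[RHS]card_ord -sum1_card; apply: eq_bigr => x _; rewrite /X eirr eqxx.
have e2 : cost e P = #|[set q : 'I_n * 'I_n | (q.1 < q.2) && X q.1 q.2]|.
  by rewrite /cost; apply: eq_card => q; rewrite !inE hf.
have e3 : \sum_x \sum_y (e x y && (f x == f y) : nat) = (internal f).*2.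
  rewrite -(sum_edges esym eirr eacyc euv hd (F := fun x y => f x == f y)); last first.
    by move=> x y; rewrite eq_sym.
  by apply: eq_bigr => x _; rewrite [RHS]big_mkcond; apply: eq_bigr => y _; case: (e x y).
have e4 : \sum_x \sum_y (e x y : nat) + 2 = n.*2.
  have := sum_edges esym eirr eacyc euv hd (F := fun _ _ => 1) (fun _ _ => erefl).
  rewrite !sum1_card => h.
  rewrite (_ : \sum_x \sum_y (e x y : nat) = \sum_x \sum_(y | e x y) 1).
    by rewrite h [in RHS](card_double_star esym eirr eacyc euv hd); lia.
  by apply: eq_bigr => x _; rewrite [RHS]big_mkcond; apply: eq_bigr => y _; case: (e x y).
have e5 : \sum_x \sum_y (X x y : nat) + (internal f).*2.*2 =
    \sum_x \sum_y (f x == f y : nat) + \sum_x \sum_y (e x y : nat).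
  rewrite -e3 -addnn -!big_split /=; apply: eq_bigr => x _; rewrite -!big_split /=.
  by apply: eq_bigr => y _; rewrite /X; case: (e x y) (f x == f y) => [] [].
have e6 : \sum_x \sum_y (f x == f y : nat) = \sum_x #|cluster f x|.
  apply: eq_bigr => x _; rewrite -sum1_card [RHS]big_mkcond; apply: eq_bigr => y _.
  by rewrite inE eq_sym; case: (f y == f x).
rewrite -e6 e2; lia.
Qed.
End Cost.

(** * Fair sets and optimality *)

Section Colours.
Variables (n k : nat) (c : 'I_n -> 'I_k).

Lemma card_by_colour (S : {set 'I_n}) : #|S| = \sum_i #|S :&: color_class c i|.
Proof.
rewrite -sum1_card (partition_big c predT) //=; apply: eq_bigr => i _.
by rewrite -sum1_card; apply: eq_bigl => x; rewrite !inE.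
Qed.

Lemma sum_by_colour (X : {set 'I_n}) (p : pred 'I_n) :
  \sum_(x in X) p x = \sum_i #|[set x in X | p x] :&: color_class c i|.
Proof.
rewrite -card_by_colour -sum1_card big_mkcond [RHS]big_mkcond; apply: eq_bigr => x _.
by rewrite inE; case: (x \in X) (p x) => [] [].
Qed.

Variables (g d : nat) (cc : 'I_k -> nat).
Hypotheses (g0 : 0 < g) (cc0 : forall i, 0 < cc i).
Hypotheses (hN : forall i, #|color_class c i| = g * cc i) (hd : d = \sum_i cc i).

Lemma card_colours : n = g * d.
Proof.
have := card_by_colour [set: 'I_n]; rewrite cardsT card_ord => {1}->.
by rewrite hd big_distrr; apply: eq_bigr => i _; rewrite setTI hN.
Qed.

Definition balanced (S : {set 'I_n}) m := forall i, #|S :&: color_class c i| = m * cc i.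

Lemma balanced_card S m : balanced S m -> #|S| = m * d.
Proof. by move=> h; rewrite card_by_colour hd big_distrr; apply: eq_bigr => i _. Qed.

(** Clear the denominators, which are nonzero as [S] is nonempty, and cancel [g] from
    [n = g * d]. *)
Lemma fair_setP S : S != set0 ->
  fair_set c S <-> forall i, #|S :&: color_class c i| * d = cc i * #|S|.
Proof.
rewrite -card_gt0 => S0; have n0 : 0 < n.
  by have := max_card (mem S); rewrite card_ord; apply: leq_trans.
have nz m : 0 < m -> ((m%:R : rat) != 0)%R by rewrite Num.Theory.pnatr_eq0 lt0n.
have e i : (#|S :&: color_class c i| * n == #|color_class c i| * #|S|) =
    (#|S :&: color_class c i| * d == cc i * #|S|).
  rewrite hN; move: #|S :&: _| #|S| (cc i) card_colours => a b q ->.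
  by rewrite mulnCA -mulnA eqn_pmul2l.
split=> h i.
  have := h i; move/eqP.
  rewrite cardsT card_ord GRing.eqr_div ?nz // -!GRing.natrM Num.Theory.eqr_nat e.
  by move/eqP.
apply/eqP; rewrite cardsT card_ord GRing.eqr_div ?nz // -!GRing.natrM Num.Theory.eqr_nat e.
exact/eqP.
Qed.

Lemma balanced_fair S m : 0 < m -> balanced S m -> S != set0 -> fair_set c S.
Proof.
move=> m0 hb S0; apply/fair_setP => // i.
by rewrite hb (balanced_card hb); lia.
Qed.

Hypothesis coprime_cc : forall q, (forall i, q %| cc i) -> q = 1.

(** The size [d] divides [cc i * #|S|] for every [i], hence also the gcd of these products, which is
    [#|S|] because the [cc i] are coprime. *)
Lemma fair_balanced S : S != set0 -> fair_set c S -> exists2 m, 0 < m & balanced S m.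
Proof.
move=> S0 /(fair_setP S0) h.
have d0 : 0 < d.
  case/set0Pn: (S0) => x _; rewrite hd (bigD1 (c x)) //= addn_gt0 cc0 //.
have : d %| #|S|.
  have hG : \big[gcdn/0]_i cc i = 1.
    by apply: coprime_cc => i; apply: (elimT (dvdn_biggcdP predT cc _) (dvdnn _)).
  have : d %| \big[gcdn/0]_i (cc i * #|S|).
    by apply/dvdn_biggcdP => i _; rewrite -h dvdn_mull.
  by rewrite -(big_morph (fun m => m * #|S|) (fun a b => muln_gcdl a b _) (mul0n _)) hG mul1n.
case/dvdnP => m hm; exists m.
  by move: S0; rewrite -card_gt0 hm; case: m {hm}.
move=> i; apply/eqP; rewrite -(eqn_pmul2r d0) h hm; lia.
Qed.

Variable T : eqType.
Implicit Types f : 'I_n -> T.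

Definition good_clusters f := forall x, exists2 m, 0 < m & balanced (cluster f x) m.

Lemma cluster_self f x : x \in cluster f x. Proof. by rewrite inE. Qed.

Lemma cluster_eq f x y : y \in cluster f x -> cluster f y = cluster f x.
Proof. by rewrite inE => /eqP h; apply/setP => z; rewrite !inE h. Qed.

Lemma good_clusters_ge f x : good_clusters f -> d <= #|cluster f x|.
Proof. by move=> hf; have [m m0 hm] := hf x; rewrite (balanced_card hm) leq_pmull. Qed.

(** Every vertex contributes at least [d]; the excess is kept only on [X], later the clusters of the
    two centres, since no other cluster contains an edge. *)
Lemma sum_cluster_excess f (X : {set 'I_n}) : good_clusters f ->
  n * d + \sum_(x in X) (#|cluster f x| - d) <= \sum_x #|cluster f x|.
Proof.
move=> hf; rewrite -[X in X * d + _]card_ord -sum_nat_const.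
rewrite (@leq_trans (\sum_(x : 'I_n) (d + (#|cluster f x| - d)))) //.
  rewrite big_split /= leq_add2l [X in _ <= X](bigID (mem X)) /= leq_addr //.
by apply: leq_sum => x _; rewrite subnKC // good_clusters_ge.
Qed.

Lemma sum_over_cluster f x (F : nat -> nat) :
  \sum_(y in cluster f x) F #|cluster f y| = #|cluster f x| * F #|cluster f x|.
Proof.
rewrite (eq_bigr (fun=> F #|cluster f x|)) ?sum_nat_const //.
by move=> y /cluster_eq ->.
Qed.

Lemma cluster_excess1 f u : good_clusters f ->
  n * d + #|cluster f u| * (#|cluster f u| - d) <= \sum_x #|cluster f x|.
Proof.
move=> hf; have := sum_cluster_excess (cluster f u) hf.
by rewrite (sum_over_cluster f u (fun s => s - d)).
Qed.

Lemma cluster_excess2 f u v : good_clusters f -> f u != f v ->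
  n * d + (#|cluster f u| * (#|cluster f u| - d) + #|cluster f v| * (#|cluster f v| - d))
    <= \sum_x #|cluster f x|.
Proof.
move=> hf huv; have := sum_cluster_excess (cluster f u :|: cluster f v) hf.
have dis : [disjoint cluster f u & cluster f v].
  rewrite -setI_eq0; apply/eqP/setP => x; rewrite !inE.
  by case: eqP => //= ->; rewrite (negPf huv).
rewrite (_ : \sum_(x in _ :|: _) _ = \sum_(x in cluster f u) (#|cluster f x| - d) +
    \sum_(x in cluster f v) (#|cluster f x| - d)); last first.
  by rewrite -bigU //; apply: eq_bigl => x; rewrite !inE.
by rewrite (sum_over_cluster f u (fun s => s - d)) (sum_over_cluster f v (fun s => s - d)).
Qed.

(* The largest number of vertices of [X] that can join [w] in a cluster of the minimum size. *)
Definition capacity w (X : {set 'I_n}) :=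
  \sum_i minn (cc i - (c w == i)) #|X :&: color_class c i|.

(** Colour by colour: the cluster offers [m * cc i] places, one of them taken by [w] in its own
    colour, and [(m - 1) * cc i] of them exceed the minimum size. *)
Lemma internal_le_capacity f w (X : {set 'I_n}) m : 0 < m -> balanced (cluster f w) m ->
  w \notin X -> \sum_(x in X) (f w == f x) <= capacity w X + m.-1 * d.
Proof.
move=> m0 hb hw; rewrite sum_by_colour hd big_distrr -big_split /=.
apply: leq_sum => i _.
set S := _ :&: _.
have h1 : #|S| <= #|X :&: color_class c i|.
  by apply: subset_leq_card; apply/subsetP => x; rewrite !inE => /andP[/andP[-> _] ->].
have h2 : #|S| + (c w == i) <= m * cc i.
  rewrite -hb [X in _ <= X](cardsD1 w) in_setI cluster_self [w \in color_class c i]inE addnC leq_add2l.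
  apply: subset_leq_card; apply/subsetP => x; rewrite !inE => /andP[/andP[hx /eqP->] ->].
  by rewrite eqxx !andbT; apply: contraNneq hw => <-.
case: m m0 {hb} h2 => // m _; rewrite /= mulSn.
move: h1 (cc0 i) (leq_b1 (c w == i)); move: (nat_of_bool _) (m * cc i) => b q.
move: #|S| #|X :&: _| (cc i) => s t a; clear => h1 h2 h3 h4.
by rewrite addn_minl leq_min; apply/andP; split; lia.
Qed.

(** The second hypothesis expresses that [X] is served first: if a vertex of [X] of some colour is
    left out, all places of that colour are held by [X] or by [w]. So either all of [X] in that
    colour is in, or the places are exhausted. *)
Lemma internal_ge_capacity (h : 'I_n -> nat) w (X : {set 'I_n}) :
  (forall i, #|[set x | (c x == i) && (h x == h w)]| = cc i) ->
  (forall x y, x \in X -> h x != h w -> c y = c x -> h y = h w -> (y \in X) || (y == w)) ->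
  capacity w X <= \sum_(x in X) (h w == h x).
Proof.
move=> hcard hX; rewrite sum_by_colour; apply: leq_sum => i _.
set S := [set x in X | _] :&: _.
have [/existsP[x /and3P[hx /eqP hi hh]]|hno] :=
    boolP [exists x, [&& x \in X, c x == i & h x != h w]]; last first.
  rewrite geq_min; apply/orP; right; apply: subset_leq_card; apply/subsetP => x.
  rewrite !inE => /andP[hx hi]; rewrite hx hi andbT /= eq_sym.
  by move/existsPn: hno => /(_ x); rewrite hx hi /= negbK.
rewrite geq_min; apply/orP; left; rewrite leq_subLR -(hcard i).
have sub : [set y | (c y == i) && (h y == h w)] \subset
    [set y | (c w == i) && (y == w)] :|: S.
  apply/subsetP => y; rewrite /S !inE => /andP[/eqP hy /eqP hyw].
  have := hX x y hx hh; rewrite hi hy hyw eqxx => /(_ erefl erefl) /orP[hyX|/eqP hyw'].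
    by rewrite hyX ?hyw ?hy ?eqxx ?orbT.
  by rewrite -hyw' hy !eqxx.
apply: leq_trans (subset_leq_card sub) _; apply: leq_trans (leq_card_setU _ _) _.
rewrite leq_add2r; case: (c w == i) => /=.
  by rewrite (_ : [set y | y == w] = [set w]) ?cards1 //; apply/setP => y; rewrite !inE.
by rewrite (_ : [set y | false] = set0) ?cards0 //; apply/setP => y; rewrite !inE.
Qed.
End Colours.

Lemma excess_absorbs m d : 0 < m -> 1 < d -> 4 * (m.-1 * d) <= m * d * (m * d - d).
Proof.
case: m => // m _ hd; rewrite mulSn addKn /= -mulSn.
case: m => // m; have : 4 <= m.+2 * d by nia.
by move=> h; rewrite leq_mul2r h orbT.
Qed.

(** * Lower bounds on the cost of every fair clustering *)

Section Optimality.
Variables (n k : nat) (e : rel 'I_n) (c : 'I_n -> 'I_k).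
Hypotheses (esym : symmetric e) (eirr : irreflexive e) (eacyc : acyclic_graph e).
Variables (u v : 'I_n).
Hypotheses (euv : e u v) (hdom : dominates e u v).
Variables (g d : nat) (cc : 'I_k -> nat).
Hypotheses (g0 : 0 < g) (cc0 : forall i, 0 < cc i).
Hypotheses (hN : forall i, #|color_class c i| = g * cc i) (hd : d = \sum_i cc i).
Variable T : eqType.
Implicit Types f : 'I_n -> T.

Local Notation internal := (internal e u v).
Local Notation good f := (good_clusters c cc f).

Lemma internal_joined f : f u = f v -> (internal f).+1 = #|cluster f u|.
Proof.
move=> fuv; rewrite -sum1_card big_mkcond.
rewrite (sum_double_star esym eirr eacyc euv hdom) /internal !inE fuv !eqxx.
congr (1 + 1 + (_ + _)); apply: eq_bigr => x _; rewrite inE ?fuv eq_sym;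
  by case: (f x == f v).
Qed.

Lemma internal_le_capacities f mu mv : f u != f v -> 0 < mu -> 0 < mv ->
  balanced c cc (cluster f u) mu -> balanced c cc (cluster f v) mv ->
  internal f <= capacity c cc u (leaves e u v) + mu.-1 * d +
    (capacity c cc v (leaves e v u) + mv.-1 * d).
Proof.
move=> fuv mu0 mv0 hu hv; rewrite /internal (negPf fuv) add0n; apply: leq_add.
  by apply: (internal_le_capacity cc0 hd) => //; rewrite inE eirr.
by apply: (internal_le_capacity cc0 hd) => //; rewrite inE eirr.
Qed.

(** As [d > 1], there is a second colour; a vertex of it is a leaf of [u] or [v] and can join its
    centre. This is needed when the centres cannot share a cluster of minimum size. *)
Lemma capacity_pos : 1 < d -> c u = c v -> cc (c u) = 1 ->
  0 < capacity c cc u (leaves e u v) + capacity c cc v (leaves e v u).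
Proof.
move=> d1 cuv c1.
have [i hi] : exists i, i != c u.
  apply/existsP; apply: contraLR d1 => /existsPn h; rewrite hd (bigD1 (c u)) //= c1 big1 //.
  by move=> i hi; have := h i; rewrite hi.
have : 0 < #|color_class c i| by rewrite hN muln_gt0 g0 cc0.
rewrite card_gt0 => /set0Pn[x]; rewrite inE => /eqP hx.
have hxu : x != u by apply: contraNneq hi => <-; rewrite hx.
have hxv : x != v by apply: contraNneq hi => hxv; rewrite cuv -hxv hx.
have pos w (X : {set 'I_n}) : c w != i -> x \in X -> 0 < capacity c cc w X.
  move=> hw hX; rewrite /capacity (bigD1 i) //= (negPf hw) subn0 addn_gt0 leq_min cc0 /=.
  by rewrite card_gt0; apply/orP; left; apply/set0Pn; exists x; rewrite !inE hX hx eqxx.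
rewrite addn_gt0; case/or4P: (hdom x) => [||h|h]; rewrite ?(negPf hxu) ?(negPf hxv) //.
  by rewrite pos // ?inE ?h // eq_sym.
by rewrite (pos v) ?orbT // ?inE ?h // -cuv eq_sym.
Qed.

(** All clusters of a candidate have size [d], so its sum of cluster sizes is [n * d]; through
    [cost_formula] the conclusion compares costs, with [IS] and [IM] as the scores of the two
    candidates. *)
Lemma optimal_of_scores f IS IM : 1 < d -> good f ->
  capacity c cc u (leaves e u v) + capacity c cc v (leaves e v u) <= IS ->
  ((c u != c v) || (1 < cc (c u)) -> d <= IM.+1) ->
  n * d + 4 * internal f <= \sum_x #|cluster f x| + 4 * maxn IS IM.
Proof.
move=> d1 hf hS hM.
have [mu mu0 bu] := hf u; have [mv mv0 bv] := hf v.
have su := balanced_card hd bu; have sv := balanced_card hd bv.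
have au := excess_absorbs mu0 d1; have av := excess_absorbs mv0 d1.
case: (eqVneq (f u) (f v)) => fuv.
  have ex := cluster_excess1 hd u hf; rewrite su in ex.
  have hI := internal_joined fuv; rewrite su in hI.
  have [/hM hIM|] := boolP ((c u != c v) || (1 < cc (c u))).
    have : IM <= maxn IS IM by rewrite leq_maxr.
    have : mu * d = mu.-1 * d + d.
      by case: mu mu0 {bu su au ex hI} => // m _; rewrite mulSn addnC.
    move: (maxn _ _) (mu.-1 * d) (mu * d * (mu * d - d)) au ex hI hIM => J p q au ex hI hIM; lia.
  rewrite negb_or negbK -leqNgt => /andP[/eqP cuv hc1].
  have c1 : cc (c u) = 1 by have := cc0 (c u); lia.
  have m2 : 1 < mu.
    have := bu (c u); rewrite c1 muln1 => <-.
    have -> : 2 = #|[set u; v]| by rewrite cards2 (edge_neq eirr euv).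
    apply: subset_leq_card; apply/subsetP => x; rewrite !inE => /orP[]/eqP->.
      by rewrite !eqxx.
    by rewrite fuv cuv !eqxx.
  have IS1 : 0 < IS := leq_trans (capacity_pos d1 cuv c1) hS.
  have : IS <= maxn IS IM by rewrite leq_maxl.
  move: (maxn _ _) => J hJ.
  (* The constant 8 is 4 for the [mu * d - 1] edges of the joined cluster plus 4 for the one edge
     that the split candidate keeps. Equality occurs at [mu = d = 2]. *)
  have hq : 4 * (mu * d) <= mu * d * (mu * d - d) + 8.
    have hmd : d * 2 <= mu * d by rewrite mulnC leq_mul2r m2 orbT.
    move: (mu * d) hmd => s hmd; clear - hmd d1.
    have [s' hs'] : exists s', s = d + s' by exists (s - d); lia.
    rewrite hs' addKn in hmd *; nia.
  lia.
have ex := cluster_excess2 hd hf fuv; rewrite su sv in ex.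
have hI := internal_le_capacities fuv mu0 mv0 bu bv.
have : IS <= maxn IS IM by rewrite leq_maxl.
move: (maxn _ _) => J hJ; lia.
Qed.

Lemma optimal_of_matching f J : d = 1 -> good f -> 0 < J ->
  (leaves e u v != set0) + (leaves e v u != set0) <= J ->
  n + 4 * internal f <= \sum_x #|cluster f x| + 2 * J.
Proof.
move=> d1 hf J0 hJ.
(* Over the integers this is [0 <= (s - 2) (s - 3)]: no cluster around a centre is better than a
   pair. *)
have quad s : 0 < s -> 4 * s.-1 <= s * (s - 1) + 2.
  by clear; case: s => [|[|[|[|s]]]] // _; rewrite subn1 /=; nia.
have s0 w : 0 < #|cluster f w| by rewrite card_gt0; apply/set0Pn; exists w; rewrite inE.
case: (eqVneq (f u) (f v)) => fuv.
  have := cluster_excess1 hd u hf; have := quad _ (s0 u); have := internal_joined fuv.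
  by rewrite d1 muln1 => <- /=; move: (_ * _) J0 => q; clear; lia.
have side w z : w \notin leaves e w z ->
    4 * \sum_(x in leaves e w z) (f w == f x) <=
    #|cluster f w| * (#|cluster f w| - 1) + 2 * (leaves e w z != set0).
  move=> hw; case: (eqVneq (leaves e w z) set0) => [->|_]; first by rewrite big_set0.
  rewrite muln1; apply: leq_trans (quad _ (s0 w)); rewrite leq_pmul2l //.
  rewrite (cardsD1 w) inE eqxx add1n /= -sum1_card big_mkcond [X in _ <= X]big_mkcond.
  apply: leq_sum => x _; rewrite !inE; case: ifP => // hx; rewrite [f w == _]eq_sym.
  case: (f x == f w) => //; rewrite andbT; case: (eqVneq x w) => // hxw.
  by subst x; move: hw; rewrite inE hx.
have := cluster_excess2 hd hf fuv; rewrite d1 muln1.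
have := side u v; have := side v u; rewrite !inE !eirr /= => /(_ isT) h1 /(_ isT) h2.
rewrite /internal (negPf fuv) add0n.
move: (_ * (_ - _)) (_ * (_ - _)) h1 h2 => p q h1 h2 h3.
move: h1 h2 h3 hJ; move: (nat_of_bool _) (nat_of_bool _) => a b.
move: (\sum_(x in leaves e v u) _) (\sum_(x in leaves e u v) _) (\sum_x _) => x y z.
clear; lia.
Qed.
End Optimality.

(** * The computed clusterings *)

Definition program :=
  prologue ++ items_comp 65 main_items ++ epilogue 12 (65 + items_size main_items) ++ [:: Halt].

Lemma exec_halt prog p m : nth Halt prog p = Halt -> exec prog 0 p m = Some m.
Proof. by rewrite /= /step => ->. Qed.

Lemma program_run n (inp : memory) : inp 0 = n ->
  (forall a, 3 * n <= a -> 1 < a -> inp a = 0) ->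
  exists T m st, [/\ T <= (items_size main_items + 141) * n + (items_size main_items + 141),
    exec program T 0 inp = Some m, sV st 0 = n,
    sA st = fun a i => if a == 0 then inp (i + 2) else 0 &
    forall v, v < n -> m v = sA (items_den main_items st) 12 v].
Proof.
move=> h0 hz; have : code_at program 0 program by [].
rewrite {2}/program => /code_at_cat[c1 /code_at_cat[c2 /code_at_cat[c3 c4]]].
have [T1 [m1 [st [t1 r1 rep1 v0 a0]]]] := prologue_reach c1 h0 hz.
have s1 : 0 + size prologue = 65 by [].
rewrite s1 in c2 c3 c4.
have [T2 [m2 [t2 r2 rep2]]] := items_reach c2 main_items_wf rep1.
rewrite size_items_comp in c3 c4.
have v2 : sV (items_den main_items st) 0 = n by rewrite items_frameV.
have [T3 [m3 [t3 r3 hm3]]] := epilogue_reach c3 isT rep2 v2.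
have s3 : size (epilogue 12 (65 + items_size main_items)) = 87 by [].
rewrite s3 in c4.
exists (T1 + (T2 + T3)), m3, st; split=> //.
  rewrite v0 in t2; move: (items_size _) t2 => s t2; nia.
have := reach_trans r1 (reach_trans r2 r3); move/(_ 0); rewrite addn0 => ->.
by have [i4 _] := code_at_head c4; apply: exec_halt.
Qed.

(** * Every block takes the same number of vertices of a colour *)

Section RankLabel.
Variables (r : nat -> nat) (N : nat -> nat) (g : nat).

(** Along [s] the vertices of colour [i] have the successive ranks 0, 1, 2 and so on, so counting
    labels becomes counting quotients. *)
Lemma rank_label_count s i j : uniq s ->
  count (fun x => (r x == i) && (rank_label r N g s x == j)) s =
  count (fun q => (q * g) %/ N i == j) (iota 0 (colour_count r s i)).
Proof.
elim/last_ind: s => [|s x IH] //; rewrite rcons_uniq => /andP[hx hu].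
rewrite colour_count_rcons iotaD count_cat -IH // -cats1 count_cat cats1; congr (_ + _).
  by apply: eq_in_count => y hy; rewrite rank_label_rcons.
rewrite /= rank_label_last // addn0; case: (r x =P i) => [->|_] //=.
by rewrite addn0.
Qed.

Lemma rank_label_mono s x y : r x = r y -> index x s <= index y s ->
  rank_label r N g s x <= rank_label r N g s y.
Proof.
move=> hxy hi; rewrite /rank_label hxy leq_div2r // leq_mul2r; apply/orP; right.
by rewrite /colour_count -(subnKC hi) takeD count_cat leq_addr.
Qed.
End RankLabel.

Lemma count_iota_div q g j : 0 < q -> j < g ->
  count (fun x => x %/ q == j) (iota 0 (g * q)) = q.
Proof.
move=> q0 hj; have -> : g * q = j * q + (q + (g - j.+1) * q).
  by rewrite addnA -mulSnr -mulnDl; congr (_ * _); lia.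
rewrite !iotaD !count_cat add0n.
have -> : count (fun x => x %/ q == j) (iota 0 (j * q)) = 0.
  apply/eqP; rewrite -leqn0 leqNgt -has_count; apply/hasPn => x; rewrite mem_iota => /andP[_ hx].
  by rewrite neq_ltn ltn_divLR ?hx.
have -> : count (fun x => x %/ q == j) (iota (j * q + q) ((g - j.+1) * q)) = 0.
  apply/eqP; rewrite -leqn0 leqNgt -has_count; apply/hasPn => x; rewrite mem_iota => /andP[hx _].
  by rewrite neq_ltn orbC leq_divRL // mulSnr hx.
rewrite add0n addn0 -[RHS](size_iota (j * q)); apply/eqP; rewrite -all_count; apply/allP => x.
rewrite mem_iota => /andP[h1 h2]; rewrite eqn_leq -ltnS ltn_divLR // leq_divRL // mulSnr h2 h1 //.
Qed.

Section Rank.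
Variables (n k : nat) (c : 'I_n -> 'I_k) (r N : nat -> nat) (g : nat) (cc : 'I_k -> nat).
Hypotheses (hr : forall x : 'I_n, r x = c x) (g0 : 0 < g) (cc0 : forall i, 0 < cc i).
Hypotheses (hN : forall i : 'I_k, N i = g * cc i).
Hypotheses (hNc : forall i, N i = colour_count r (iota 0 n) i).
Variable s : seq nat.
Hypothesis hs : perm_eq s (iota 0 n).

Let lab (x : 'I_n) := rank_label r N g s x.

Lemma card_ord_count (p : pred nat) : #|[set x : 'I_n | p x]| = count p s.
Proof.
rewrite (permP hs) -val_enum_ord count_map -sum1_count big_enum_cond -sum1_card.
by apply: eq_bigl => x; rewrite !inE.
Qed.

Lemma rank_labelE (x : 'I_n) :
  lab x = colour_count r (take (index (val x) s) s) (c x) %/ cc (c x).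
Proof. by rewrite /lab /rank_label hr hN mulnC divnMl. Qed.

Lemma card_rank_class i j : j < g -> #|[set x | (c x == i) && (lab x == j)]| = cc i.
Proof.
move=> hj; rewrite -[RHS](@count_iota_div _ g j) // -hN hNc.
have us : uniq s by rewrite (perm_uniq hs) iota_uniq.
have -> : colour_count r (iota 0 n) i = colour_count r s i by rewrite /colour_count (permP hs).
rewrite -(eq_count (a1 := fun q => (q * g) %/ N i == j)); last first.
  by move=> q; rewrite hN mulnC divnMl.
rewrite -rank_label_count // -card_ord_count; apply: eq_card => x; rewrite !inE.
by rewrite -val_eqE /= hr.
Qed.

Lemma rank_label_lt x : lab x < g.
Proof.
rewrite rank_labelE ltn_divLR // -hN hNc /colour_count -(permP hs).
rewrite -[X in _ < count _ X](cat_take_drop (index (val x) s) s).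
rewrite count_cat -addn1 leq_add2l -has_count; apply/hasP; exists (val x); last by rewrite hr.
have hx : val x \in s by rewrite (perm_mem hs) mem_iota /=.
by rewrite (drop_nth (val x)) ?index_mem // nth_index // inE eqxx.
Qed.
End Rank.

(** * The split, merged and matching clusterings and their optimality *)

Section Candidates.
Variables (n k : nat) (e : rel 'I_n) (c : 'I_n -> 'I_k).
Hypotheses (esym : symmetric e) (eirr : irreflexive e) (eacyc : acyclic_graph e).
Variables (u v : 'I_n).
Hypotheses (euv : e u v) (hdom : dominates e u v).
Variables (r N : nat -> nat) (g d : nat) (cc : 'I_k -> nat).
Hypotheses (hr : forall x : 'I_n, r x = c x) (g0 : 0 < g) (cc0 : forall i, 0 < cc i).
Hypotheses (hN : forall i : 'I_k, N i = g * cc i).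
Hypotheses (hNc : forall i, N i = colour_count r (iota 0 n) i).
Hypothesis hd : d = \sum_i cc i.
Variables Lu Lv : seq nat.
Hypotheses (uLu : uniq Lu) (uLv : uniq Lv).
Hypotheses (ltLu : forall x, x \in Lu -> x < n) (ltLv : forall x, x \in Lv -> x < n).
Hypotheses (hLu : forall x : 'I_n, (val x \in Lu) = (x \in leaves e u v)).
Hypotheses (hLv : forall x : 'I_n, (val x \in Lv) = (x \in leaves e v u)).

Let neuv : val u != val v.
Proof. exact: edge_neq eirr _ _ euv. Qed.
Let uNLu : val u \in Lu = false. Proof. by rewrite hLu inE eirr. Qed.
Let uNLv : val u \in Lv = false. Proof. by rewrite hLv inE eqxx andbF. Qed.
Let vNLu : val v \in Lu = false. Proof. by rewrite hLu inE eqxx andbF. Qed.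
Let vNLv : val v \in Lv = false. Proof. by rewrite hLv inE eirr. Qed.
Let LuNLv x : x \in Lu -> x \in Lv = false.
Proof.
move=> hx; have := hx; rewrite -[x]/(val (Ordinal (ltLu hx))) hLu hLv.
by move/(leaves_disjoint esym eirr eacyc euv)/negPf.
Qed.

Lemma cover_leaves x : x < n -> [|| x == u, x == v, x \in Lu | x \in Lv].
Proof.
move=> hx; rewrite -[x]/(val (Ordinal hx)) hLu hLv !val_eqE.
by rewrite (leaves_cover esym eirr eacyc euv hdom); case: (_ == u) (_ == v) (_ \in _) => [] [] [].
Qed.

Lemma perm_split_order : perm_eq (val u :: Lu ++ rcons Lv (val v)) (iota 0 n).
Proof.
apply: uniq_perm; rewrite ?iota_uniq //.
  rewrite cons_uniq mem_cat mem_rcons inE uNLu uNLv orbF (negPf neuv) /=.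
  rewrite cat_uniq rcons_uniq uLu uLv vNLv !andbT; apply/hasPn => x.
  by rewrite mem_rcons inE => /orP[/eqP->|]; [rewrite vNLu | apply: contraL => /LuNLv ->].
move=> x; rewrite mem_iota /= !inE mem_cat mem_rcons inE.
apply/idP/idP => [|/cover_leaves]; last by case/or4P => ->; rewrite ?orbT.
by case/or4P => [/eqP->|/ltLu|/eqP->|/ltLv].
Qed.

Lemma perm_merge_order : perm_eq (val u :: val v :: Lu ++ Lv) (iota 0 n).
Proof.
by apply: perm_trans perm_split_order; rewrite perm_cons -rcons_cat perm_sym perm_rcons.
Qed.

Definition split_label (x : 'I_n) := rank_label r N g (val u :: Lu ++ rcons Lv (val v)) x.
Definition merge_label (x : 'I_n) := rank_label r N g (val u :: val v :: Lu ++ Lv) x.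

Lemma rank_balanced s : perm_eq s (iota 0 n) ->
  forall x, balanced c cc (cluster (fun x : 'I_n => rank_label r N g s x) x) 1.
Proof.
move=> hs x i; rewrite mul1n.
rewrite -[RHS](card_rank_class hr g0 cc0 hN hNc hs i (rank_label_lt hr g0 cc0 hN hNc hs x)).
by apply: eq_card => y; rewrite !inE andbC.
Qed.

(** Within a colour, labels grow along the order. The first block, numbered 0, contains [u] and is
    filled by leaves of [u] before any other vertex; the last one, numbered [g - 1], contains [v]
    and is filled from the end by leaves of [v]. *)
Lemma split_label_capacity :
  capacity c cc u (leaves e u v) + capacity c cc v (leaves e v u) <= internal e u v split_label.
Proof.
pose s := val u :: Lu ++ rcons Lv (val v).
have hcl := card_rank_class hr g0 cc0 hN hNc perm_split_order.
have hlt := rank_label_lt hr g0 cc0 hN hNc perm_split_order.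
have mono (x y : 'I_n) : c x = c y -> index (val x) s <= index (val y) s ->
    split_label x <= split_label y.
  by move=> hc; apply: rank_label_mono; rewrite !hr hc.
have hu : split_label u = 0.
  by rewrite /split_label (rank_labelE hr g0 hN) /= eqxx /= div0n.
rewrite /internal; apply: leq_trans (leq_addl _ _); apply: leq_add.
  apply: internal_ge_capacity => [i|x y hx hxu hxy hyu].
    by apply: (hcl i (split_label u)); apply: hlt.
  apply: contraR hxu; rewrite negb_or => /andP[hy hyu'].
  rewrite hu -leqn0 -hu -hyu; apply: mono => //.
  have eu : (u == y :> nat) = false by rewrite -[LHS]/(u == y) eq_sym (negPf hyu').
  rewrite /s /= eu; case: ifP => // _.
  rewrite ltnS !index_cat hLu hx hLu (negPf hy); apply: leq_trans (leq_addr _ _).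
  by rewrite ltnW // index_mem hLu.
have hs : s = rcons (val u :: Lu ++ Lv) (val v) by rewrite /s -rcons_cat.
have us : uniq s by rewrite (perm_uniq perm_split_order) iota_uniq.
have hv : (split_label v).+1 = g.
  have vs : val v \notin val u :: Lu ++ Lv by move: us; rewrite hs rcons_uniq => /andP[].
  rewrite /split_label (rank_labelE hr g0 hN) -/s hs -cats1 index_cat (negPf vs) [index _ [:: _]]/=.
  rewrite eqxx addn0 take_size_cat //; set m := colour_count _ _ _.
  have hm : m.+1 = g * cc (c v).
    rewrite -hN hNc /colour_count -(permP perm_split_order) -/s hs -[count _ _]/(colour_count r _ _).
    by rewrite colour_count_rcons hr eqxx addn1.
  (* The vertex [v] is the last of its colour, hence the last in block [g - 1]. *)
  have -> : m = g.-1 * cc (c v) + (cc (c v)).-1.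
    by apply: succn_inj; rewrite hm -addnS prednK // -mulSnr prednK.
  by rewrite divnMDl // divn_small ?addn0 prednK.
apply: internal_ge_capacity => [i|x y hx hxv hxy hyv].
  by apply: (hcl i (split_label v)); apply: hlt.
apply: contraR hxv; rewrite negb_or => /andP[hy hyv'].
have : split_label y <= split_label x.
  apply: mono => //; rewrite /s -cat_cons !index_cat.
  have -> : (val x \in val u :: Lu) = false.
    rewrite inE; apply/negP => /orP[/eqP/val_inj hxu|].
      by move: hx; rewrite hxu inE eqxx andbF.
    by move/LuNLv; rewrite hLv hx.
  have -> : val y \in val u :: Lu.
    have := cover_leaves (ltn_ord y); rewrite inE hLv (negPf hy).
    rewrite -[y == v :> nat]/(y == v) (negPf hyv') orbF /=.
    by case/orP => ->; rewrite ?orbT.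
  have hyi : index (val y) (val u :: Lu) <= size (val u :: Lu) by exact: index_size.
  exact: leq_trans hyi (leq_addr _ _).
rewrite hyv => hle; have := hlt x; rewrite -/(split_label x) -hv ltnS => hle'.
by apply/eqP/anti_leq; rewrite hle hle'.
Qed.

(** The vertex [u] has rank 0 in its colour, and [v] has rank 0 or, if the colours agree, rank 1,
    which is still in block 0 when blocks have at least two places. *)
Lemma merge_label_joined : (c u != c v) || (1 < cc (c u)) ->
  merge_label u = merge_label v.
Proof.
move=> h; rewrite /merge_label !(rank_labelE hr g0 hN) /= eqxx /= div0n.
have -> : (u == v :> nat) = false by exact: negPf neuv.
rewrite eqxx /= /colour_count /= addn0 !hr val_eqE.
case: (eqVneq (c u) (c v)) h => [<- /= h|_ _]; last by rewrite div0n.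
by rewrite divn_small.
Qed.

Lemma merge_label_score : (c u != c v) || (1 < cc (c u)) ->
  d <= (internal e u v merge_label).+1.
Proof.
move/merge_label_joined => h; rewrite (internal_joined esym eirr eacyc euv hdom h).
by rewrite (balanced_card hd (rank_balanced perm_merge_order u)) mul1n.
Qed.

(** Each centre takes the label of its last leaf. One default serves both: if only [u] lacks leaves,
    [v] has given up the label [v] and [u] is alone under it; if only [v] does, it keeps its own
    label; if both do, they are matched with each other. *)
Definition matching_label (x : 'I_n) :=
  if val x == val v then last (val v) Lv else if val x == val u then last (val v) Lu else val x.

Lemma matching_label_u : matching_label u = last (val v) Lu.
Proof. by rewrite /matching_label (negPf neuv) eqxx. Qed.

Lemma matching_label_v : matching_label v = last (val v) Lv.
Proof. by rewrite /matching_label eqxx. Qed.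

Lemma matching_label_leaf x : x != u -> x != v -> matching_label x = val x.
Proof. by move=> hu hv; rewrite /matching_label !val_eqE (negPf hu) (negPf hv). Qed.

(** Since all pairs inside clusters are edges, the sum of the cluster sizes is [n] plus twice the
    number of internal edges. *)
Lemma matching_label_edge x y : x != y -> matching_label x = matching_label y -> e x y.
Proof.
have evu : e v u by rewrite esym.
have hv z : z != v -> matching_label v = matching_label z -> e v z.
  move=> hz; case: (eqVneq z u) => [-> //|hzu].
  rewrite (@matching_label_leaf z) // matching_label_v => h.
  have := mem_last (val v) Lv; rewrite h inE val_eqE (negPf hz) hLv inE.
  by case/andP.
have hu z : z != u -> matching_label u = matching_label z -> e u z.
  move=> hz; case: (eqVneq z v) => [-> //|hzv].
  rewrite (@matching_label_leaf z) // matching_label_u => h.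
  have := mem_last (val v) Lu; rewrite h inE val_eqE (negPf hzv) hLu inE.
  by case/andP.
move=> hxy hl.
case: (eqVneq x v) hxy hl => [-> hxy hl|xv hxy hl]; first by apply: hv; rewrite // eq_sym.
case: (eqVneq y v) hxy hl => [-> hxy hl|yv hxy hl]; first by rewrite esym; apply: hv.
case: (eqVneq x u) xv hxy hl => [-> _ hxy hl|xu xv hxy hl]; first by apply: hu; rewrite // eq_sym.
case: (eqVneq y u) yv hxy hl => [-> _ hxy hl|yu yv hxy hl]; first by rewrite esym; apply: hu.
by move: hl; rewrite !matching_label_leaf // => /val_inj hl; rewrite hl eqxx in hxy.
Qed.

Lemma matching_score :
  (leaves e u v != set0) + (leaves e v u != set0) <= internal e u v matching_label.
Proof.
have evu : e v u by rewrite esym.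
have one w z l : (forall x : 'I_n, (val x \in l) = (x \in leaves e w z)) ->
    (forall x, x \in l -> x < n) -> (forall x, x \in leaves e w z -> (x != u) && (x != v)) ->
    matching_label w = last (val v) l ->
    (leaves e w z != set0) <= \sum_(x in leaves e w z) (matching_label w == matching_label x).
  move=> hl ltl hx hw; case: (set_0Vmem (leaves e w z)) => [->|[x0 hx0]]; first by rewrite eqxx.
  rewrite -hl in hx0; case: l hl ltl hx hw hx0 => // a l hl ltl hx hw _.
  have hm : last a l \in a :: l by rewrite mem_last.
  pose y := Ordinal (ltl _ hm); have hy : y \in leaves e w z by rewrite -hl.
  have /andP[hyu hyv] := hx _ hy.
  by rewrite (bigD1 y) //= hw (@matching_label_leaf y) // eqxx; case: (leaves e w z != set0).
rewrite /internal; apply: leq_trans (leq_addl _ _); apply: leq_add.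
  apply: (one _ _ Lu) => // [x|]; last exact: matching_label_u.
  by rewrite (leaves_cover esym eirr eacyc evu (dominates_sym hdom)) => /and3P[-> ->].
apply: (one _ _ Lv) => // [x|]; last exact: matching_label_v.
by rewrite (leaves_cover esym eirr eacyc euv hdom) => /and3P[-> ->].
Qed.

Lemma matching_score_pos : 0 < internal e u v matching_label.
Proof.
have nil w z l : (forall x : 'I_n, (val x \in l) = (x \in leaves e w z)) ->
    (forall x, x \in l -> x < n) -> leaves e w z = set0 -> l = [::].
  move=> hl ltl h0; case: l hl ltl => // a l hl ltl.
  by have := hl (Ordinal (ltl a (mem_head a l))); rewrite h0 [RHS]inE /= mem_head.
case: (eqVneq (leaves e u v) set0) matching_score => [eu|_] h; last first.
  by apply: leq_trans h; rewrite add1n.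
case: (eqVneq (leaves e v u) set0) h => [ev|_] h; last by apply: leq_trans h; rewrite addn1.
rewrite /internal matching_label_u matching_label_v.
by rewrite (nil _ _ _ hLu ltLu eu) (nil _ _ _ hLv ltLv ev) eqxx.
Qed.
Hypothesis coprime_cc : forall q, (forall i, q %| cc i) -> q = 1.

Lemma card_color_class i : #|color_class c i| = g * cc i.
Proof.
rewrite -hN hNc /colour_count -(card_ord_count (perm_refl _) (fun x => r x == i)).
by apply: eq_card => x; rewrite !inE hr.
Qed.

Definition labels (P : {set {set 'I_n}}) (h : 'I_n -> nat) :=
  [/\ partition P [set: 'I_n], forall x y, same_cluster P x y = (h x == h y) &
      forall S, S \in P -> exists x, S = cluster h x].

Lemma cluster_neq0 (T : eqType) (h : 'I_n -> T) x : cluster h x != set0.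
Proof. by apply/set0Pn; exists x; rewrite inE. Qed.

(** A competing partition is labelled by its own blocks; this is why the lower bounds allow labels
    in any [eqType]. *)
Lemma fair_good_clusters Q : fair_clustering c Q -> good_clusters c cc (pblock Q).
Proof.
move=> [pQ fQ] x; have /and3P[/eqP cQ tQ _] := pQ.
apply: (fair_balanced g0 cc0 card_color_class hd coprime_cc); first exact: cluster_neq0.
have -> : cluster (pblock Q) x = pblock Q x.
  by apply/setP => y; rewrite inE eq_sym eq_pblock // cQ inE.
by apply: fQ; rewrite pblock_mem // cQ inE.
Qed.

Lemma min_cost_of_scores P h : 1 < d -> labels P h ->
  (forall x, balanced c cc (cluster h x) 1) ->
  internal e u v h = maxn (internal e u v split_label) (internal e u v merge_label) ->
  min_cost_fair_clustering e c P.
Proof.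
move=> d1 [pP sP cP] bh hmax; split.
  split=> // S /cP[x ->]; apply: (balanced_fair g0 card_color_class hd (m := 1)) => //.
  exact: cluster_neq0.
move=> Q /fair_good_clusters gQ.
have := cost_formula esym eirr eacyc euv hdom sP.
have := cost_formula esym eirr eacyc euv hdom (P := Q) (f := pblock Q) (fun x y => erefl).
have := optimal_of_scores esym eirr eacyc euv hdom g0 cc0 card_color_class hd d1 gQ
  split_label_capacity merge_label_score.
rewrite -hmax (eq_bigr (fun=> d) (F1 := fun x => #|cluster h x|)); last first.
  by move=> x _; rewrite (balanced_card hd (bh x)) mul1n.
rewrite sum_nat_const card_ord.
by move: (\sum_x _) (internal e u v h) (internal e u v _) (n * d) => a b b' q; clear; lia.
Qed.

Lemma min_cost_of_matching P : d = 1 -> labels P matching_label ->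
  min_cost_fair_clustering e c P.
Proof.
move=> d1 [pP sP cP].
have cc1 i : cc i = 1.
  by apply/eqP; rewrite eqn_leq cc0 andbT -d1 hd (bigD1 i) //= leq_addr.
(* With [d = 1] a colour class has [g = n] elements, so there is one colour and every nonempty set
   is fair. *)
have hcol i : color_class c i = [set: 'I_n].
  apply/eqP; rewrite eqEcard subsetT cardsT card_ord card_color_class cc1.
  have hng := card_colours card_color_class hd; rewrite d1 in hng. by rewrite -hng leqnn.
split.
  split=> // S /cP[x ->].
  apply: (balanced_fair g0 card_color_class hd (m := #|cluster matching_label x|)).
  - by rewrite card_gt0 cluster_neq0.
  - by move=> i; rewrite hcol setIT cc1 muln1.
  - exact: cluster_neq0.
move=> Q /fair_good_clusters gQ.
have := cost_formula esym eirr eacyc euv hdom sP.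
have := cost_formula esym eirr eacyc euv hdom (P := Q) (f := pblock Q) (fun x y => erefl).
have := optimal_of_matching esym eirr eacyc euv hdom hd d1 gQ matching_score_pos matching_score.
have -> : \sum_x #|cluster matching_label x| = n + 2 * internal e u v matching_label.
  rewrite mul2n -(sum_edges esym eirr eacyc euv hdom
    (F := fun x y => matching_label x == matching_label y)); last by move=> x y; rewrite eq_sym.
  rewrite -[X in X + _]card_ord -sum1_card -big_split /=; apply: eq_bigr => x _.
  rewrite (cardsD1 x) inE eqxx; congr (1 + _).
  rewrite -sum1_card big_mkcond [RHS]big_mkcond; apply: eq_bigr => y _.
  rewrite !inE [matching_label y == _]eq_sym; case: (eqVneq y x) => [->|hyx] /=.
    by rewrite eirr.
  case: eqP => [h|_]; last by case: (e x y).
  by rewrite (matching_label_edge _ h) // eq_sym.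
by move: (\sum_x _) (internal e u v _) (internal e u v _) => a b b'; clear; lia.
Qed.
End Candidates.

Lemma output_labels n (m : memory) :
  labels (@output_partition n m) (fun x => m (val x)).
Proof.
have pP : partition (@output_partition n m) [set: 'I_n] by apply: preim_partitionP.
have eqv : {in [set: 'I_n] & &, equivalence_rel [rel x y : 'I_n | m (val x) == m (val y)]}.
  by split=> //= /eqP->.
have hp (x y : 'I_n) : (y \in pblock (@output_partition n m) x) = (m (val x) == m (val y)).
  by rewrite pblock_equivalence_partition ?inE.
have /and3P[/eqP cP tP n0] := pP.
split=> // [x y|S hS].
  by rewrite /same_cluster eq_pblock ?cP ?inE // hp.
have /set0Pn[x hx] : S != set0 by apply: contraNneq n0 => <-.
exists x; apply/setP => y; rewrite inE eq_sym -hp.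
by rewrite (def_pblock tP hS hx).
Qed.

(** * The input format *)

Section Input.
Variables (n k : nat) (e : rel 'I_n) (c : 'I_n -> 'I_k) (L : seq (nat * nat)).
Hypotheses (esym : symmetric e) (eirr : irreflexive e) (hL : edge_list e L).

Definition input_row i := @input_mem n k c L (i + 2).

Lemma input_colour (x : 'I_n) : input_row x = c x.
Proof.
rewrite /input_row /input_mem.
have -> : (x + 2 == 0) = false by lia.
have -> : (x + 2 == 1) = false by lia.
rewrite addnC ltn_add2l ltn_ord addKn.
by case: insubP => [y _ hy|]; [congr (val (c _)); apply: val_inj | rewrite ltn_ord].
Qed.

Lemma mem_edge_list (x y : 'I_n) : e x y = ((val x, val y) \in L) || ((val y, val x) \in L).
Proof.
have [hcount hmem] := hL; apply/idP/idP => [/hcount h|].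
  have : has (fun p => (p == (val x, val y)) || (p == (val y, val x))) L by rewrite has_count h.
  by case/hasP => p hp /orP[]/eqP <-; rewrite hp ?orbT.
by case/orP => /hmem[a [b [eab [/val_inj -> /val_inj ->]]]]; rewrite // esym.
Qed.

Lemma edge_list_bounds p : p \in L -> [/\ p.1 < n, p.2 < n & p.1 != p.2].
Proof.
have [_ hmem] := hL => /hmem[a [b [eab ->]]]; split=> //=.
exact: edge_neq eirr _ _ eab.
Qed.

Lemma edge_list_degree (x : 'I_n) : \sum_(p <- L) ((p.1 == x) + (p.2 == x)) = \sum_y e x y.
Proof.
apply: double_inj.
rewrite -(sum_edge_list esym eirr hL (F := fun a b => (a == x) + (b == x))); last first.
  by move=> a b; rewrite addnC.
transitivity (\sum_(a : 'I_n) \sum_(b : 'I_n) e a b * (a == x) +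
    \sum_(a : 'I_n) \sum_(b : 'I_n) e a b * (b == x)).
  rewrite -big_split; apply: eq_bigr => a _; rewrite -big_split big_mkcond /=.
  by apply: eq_bigr => b _; rewrite -mulnDr; case: (e a b); rewrite ?mul1n.
rewrite -addnn; congr (_ + _).
  rewrite (bigD1 x) //= [X in _ + X]big1 ?addn0 => [|a /negPf ha].
    by apply: eq_bigr => b _; rewrite eqxx muln1.
  by apply: big1 => b _; rewrite ha muln0.
rewrite exchange_big (bigD1 x) //= [X in _ + X]big1 ?addn0 => [|a /negPf ha].
  by apply: eq_bigr => b _; rewrite eqxx muln1 esym.
by apply: big1 => b _; rewrite ha muln0.
Qed.

Lemma input_edges : 0 < n -> size L = n.-1 -> raw_edges n input_row L.
Proof.
move=> n0 hsz; split=> // j hj; rewrite /input_row /input_mem.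
have e1 : (n + j + j + 2 == 0) = false by lia.
have e2 : (n + j + j + 2 == 1) = false by lia.
have e3 : (n + j + j + 2 < 2 + n) = false by lia.
have e4 : n + j + j + 2 < 2 + n + 2 * size L by lia.
have f1 : (n + j + j + 1 + 2 == 0) = false by lia.
have f2 : (n + j + j + 1 + 2 == 1) = false by lia.
have f3 : (n + j + j + 1 + 2 < 2 + n) = false by lia.
have f4 : n + j + j + 1 + 2 < 2 + n + 2 * size L by lia.
rewrite e1 e2 e3 e4 f1 f2 f3 f4.
have -> : n + j + j + 2 - 2 - n = j.*2 by lia.
have -> : n + j + j + 1 + 2 - 2 - n = j.*2.+1 by lia.
rewrite /= odd_double !divn2 /= uphalf_double doubleK.
by case: (nth _ _ _).
Qed.

Lemma input_zero : 0 < n -> size L = n.-1 ->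
  forall a, 3 * n <= a -> 1 < a -> @input_mem n k c L a = 0.
Proof.
move=> n0 hsz a h1 h2; rewrite /input_mem.
have -> : (a == 0) = false by lia.
have -> : (a == 1) = false by lia.
have -> : (a < 2 + n) = false by lia.
by have -> : (a < 2 + n + 2 * size L) = false by lia.
Qed.
End Input.

(** Adjacent vertices have disjoint neighbourhoods, as there is no triangle, so two degrees summing
    to [n] exhaust the vertices. *)
Lemma dominates_of_degrees n (e : rel 'I_n) u v :
  symmetric e -> irreflexive e -> acyclic_graph e -> e u v ->
  n <= \sum_y e u y + \sum_y e v y -> dominates e u v.
Proof.
move=> esym eirr eacyc euv.
have deg w : \sum_y (e w y : nat) = #|[set y | e w y]|.
  by rewrite -sum1_card [RHS]big_mkcond; apply: eq_bigr => y _; rewrite inE; case: (e w y).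
rewrite !deg -cardsUI [X in _ + X](_ : _ = 0) ?addn0; last first.
  apply/eqP; rewrite cards_eq0; apply/eqP/setP => x; rewrite !inE.
  apply/negP => /andP[h1 h2]; apply: (no_triangle eirr eacyc euv h2); by rewrite esym.
move=> h x.
have : x \in [set y | e u y] :|: [set y | e v y].
  suff -> : [set y | e u y] :|: [set y | e v y] = [set: 'I_n] by rewrite inE.
  by apply/eqP; rewrite eqEcard subsetT cardsT card_ord.
by rewrite !inE => /orP[] ->; rewrite !orbT.
Qed.

Lemma min_cost_single n (e : rel 'I_n) k (c : 'I_n -> 'I_k) m :
  n = 1 -> min_cost_fair_clustering e c (@output_partition n m).
Proof.
move=> n1; subst n.
have [pP _ cP] := output_labels 1 m.
split=> [|Q _].
  split=> // S /cP[x ->] i.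
  have -> : cluster (fun x : 'I_1 => m (val x)) x = [set: 'I_1].
    by apply/setP => y; rewrite !inE [y]ord1 [x]ord1 eqxx.
  by rewrite setTI.
rewrite [X in X <= _](_ : _ = 0) //; apply: eq_card0 => -[x y].
by rewrite !inE [x]ord1 [y]ord1.
Qed.

Theorem mainTheorem11 :
  exists (prog : seq instr) (C : nat),
  forall (n k : nat) (e : rel 'I_n) (c : 'I_n -> 'I_k) (L : seq (nat * nat)),
    simple_graph e -> is_tree e -> diameter_le e 3 ->
    has_color_ratio c -> edge_list e L ->
    exists (T : nat) (m : memory),
      T <= C * n + C /\
      exec prog T 0 (@input_mem n k c L) = Some m /\
      min_cost_fair_clustering e c (@output_partition n m).
Proof.
exists program, (items_size main_items + 141) => n k e c L [esym eirr] [n0 [econn eacyc]] diam.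
move=> [cs [t [t0 cs0 hcs]]] hL.
have colour0 i : 0 < #|color_class c i| by rewrite hcs muln_gt0 t0 cs0.
have hsz : size L = n.-1.
  case: (ltngtP n 1) (n0) => // [n1 _|n1 _].
    have [u [v [euv hdom]]] := dominating_edge_exists esym eirr eacyc econn diam n1.
    have := sum_edges esym eirr eacyc euv hdom (F := fun _ _ => 1) (fun _ _ => erefl).
    rewrite (sum_edge_list esym eirr hL (F := fun _ _ => 1)) // => /double_inj.
    rewrite sum1_size !sum1_card => ->.
    by rewrite [in RHS](card_double_star esym eirr eacyc euv hdom).
  case: L hL => [|p L] hL; first by rewrite n1.
  by have [] := edge_list_bounds eirr hL (mem_head p L); rewrite n1 !ltnS !leqn0 => /eqP-> /eqP->.
have inp0 : @input_mem n k c L 0 = n by [].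
have [T [m [st [hT hexec v0 a0 hm]]]] := program_run inp0 (input_zero c n0 hsz).
exists T, m; split=> //; split=> //.
case: (ltngtP n 1) (n0) => // [n1 _|n1 _]; last exact: min_cost_single.
clear hT hexec.
have hr := input_colour c L; set r := input_row c L in hr.
have hraw := input_edges c n0 hsz.
(* Every colour occurs, so colours are numbered below [n] and all multiplicities are among the [n]
   entries that the gcd phase must absorb. *)
have kn : k <= n.
  have : \sum_(i < k) 1 <= \sum_i #|[set: 'I_n] :&: color_class c i|.
    by apply: leq_sum => i _; rewrite setTI; apply: colour0.
  by rewrite -card_by_colour cardsT card_ord sum1_card card_ord.
have hrk x : x < n -> r x < n.
  by move=> hx; rewrite (hr (Ordinal hx)); apply: leq_trans (ltn_ord _) kn.
have hdeg (u v : 'I_n) : e u v -> n <= \sum_y e u y + \sum_y e v y -> dominates e u v.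
  exact: dominates_of_degrees.
have hhas : has (fun p => n <= \sum_(q <- L) ((q.1 == p.1) + (q.2 == p.1)) +
    \sum_(q <- L) ((q.1 == p.2) + (q.2 == p.2))) L.
  have [u [v [euv hdom]]] := dominating_edge_exists esym eirr eacyc econn diam n1.
  have hs := degree_sum esym eirr eacyc euv hdom.
  apply/hasP; have := euv; rewrite (mem_edge_list esym hL) => /orP[] hp.
    by exists (val u, val v) => //=; rewrite !(edge_list_degree esym eirr hL) hs.
  by exists (val v, val u) => //=; rewrite !(edge_list_degree esym eirr hL) addnC hs.
have Ebnd := edge_list_bounds eirr hL.
have [un [vn [g [huvL hD g0 hg hout]]]] := main_spec n0 v0 a0 hraw hrk Ebnd hhas.
have [_ /(_ _ huvL)[u [v [euv [eu ev]]]]] := hL; subst un vn.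
rewrite !(edge_list_degree esym eirr hL) in hD.
have hdom : dominates e u v := hdeg _ _ euv hD.
set N := colour_count r (iota 0 n) in hg hout.
pose cc (i : 'I_k) := N (val i) %/ g.
have gN : g %| n /\ forall i, g %| N i by apply/hg.
have hN (i : 'I_k) : N i = g * cc i by rewrite mulnC divnK //; case: gN.
have hcard (i : 'I_k) : #|color_class c i| = N i.
  rewrite /N /colour_count -(card_ord_count (perm_refl _) (fun x => r x == i)).
  by apply: eq_card => x; rewrite !inE hr.
have cc0 (i : 'I_k) : 0 < cc i.
  by have := colour0 i; rewrite hcard hN muln_gt0 => /andP[].
have hNc i : N i = colour_count r (iota 0 n) i by [].
pose d := \sum_i cc i.
have hn : n = g * d.
  by apply: (card_colours (c := c) (cc := cc)) => // i; rewrite hcard hN.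
(* A common divisor [q] of the reduced multiplicities makes [g * q] a common divisor of the original
   ones and of [n], hence a divisor of [g]. *)
have coprime_cc q : (forall i : 'I_k, q %| cc i) -> q = 1.
  move=> hq; have : g * q %| g.
    apply/hg; split; first by rewrite hn dvdn_pmul2l // /d dvdn_sum.
    move=> i; case: (ltnP i k) => hi.
      by rewrite (hN (Ordinal hi)) dvdn_pmul2l.
    rewrite [N i](_ : _ = 0) //; apply/eqP; rewrite -leqn0 leqNgt -has_count.
    apply/hasPn => x; rewrite mem_iota /= => hx.
    by rewrite (hr (Ordinal hx)) neq_ltn (leq_trans (ltn_ord _) hi).
  by rewrite -{2}[g]muln1 dvdn_pmul2l // dvdn1 => /eqP.
pose Lu := [seq x <- iota 0 n |
  (x != val v) && (((val u, x) \in L) || ((x, val u) \in L))].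
pose Lv := [seq x <- iota 0 n | [&& x != val u, x != val v & x \notin Lu]].
have ltLu x : x \in Lu -> x < n by rewrite mem_filter mem_iota => /andP[].
have ltLv x : x \in Lv -> x < n by rewrite mem_filter mem_iota => /andP[].
have hLu (x : 'I_n) : (val x \in Lu) = (x \in leaves e u v).
  rewrite mem_filter mem_iota leq0n add0n ltn_ord andbT -(mem_edge_list esym hL) inE.
  by rewrite andbT andbC.
have hLv (x : 'I_n) : (val x \in Lv) = (x \in leaves e v u).
  rewrite mem_filter mem_iota leq0n add0n ltn_ord andbT hLu.
  by rewrite (leaves_cover esym eirr eacyc euv hdom) ?andbT.
have uLu : uniq Lu by rewrite filter_uniq ?iota_uniq.
have uLv : uniq Lv by rewrite filter_uniq ?iota_uniq.
pose lS := split_label u v r N g Lu Lv; pose lM := merge_label u v r N g Lu Lv.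
have score (f : nat -> nat) : count (fun p => f p.1 == f p.2) L =
    internal e u v (fun x : 'I_n => f (val x)).
  apply: double_inj; rewrite -sum1_count big_mkcond.
  rewrite -(sum_edge_list esym eirr hL (F := fun a b => if f a == f b then 1 else 0)); last first.
    by move=> a b; rewrite eq_sym.
  rewrite -(sum_edges esym eirr eacyc euv hdom (F := fun a b => f (val a) == f (val b))); last first.
    by move=> a b; rewrite eq_sym.
  by apply: eq_bigr => a _; apply: eq_bigr => b _; case: (_ == _).
have [pP sP cP] := output_labels n m.
have hval (x : 'I_n) : m (val x) = final_label n g (val u) (val v) Lu Lv L
    (rank_label r N g (val u :: Lu ++ rcons Lv (val v)))
    (rank_label r N g (val u :: val v :: Lu ++ Lv)) (val x).
  rewrite hm; last exact: ltn_ord.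
  exact: (hout Lu Lv (val x) erefl erefl (ltn_ord x)).
have lab h : (fun x : 'I_n => m (val x)) =1 h -> labels (@output_partition n m) h.
  move=> hh; split=> // [x y|S /cP[z ->]]; first by rewrite sP !hh.
  by exists z; apply/setP => y; rewrite !inE !hh.
have d0 : 0 < d by move: n0; rewrite hn muln_gt0 => /andP[].
case: (ltngtP d 1) (d0) => // [d1 _|d1 _]; last first.
  apply: (min_cost_of_matching esym eirr eacyc euv hdom hr g0 cc0 hN hNc (erefl d)
    ltLu ltLv hLu hLv coprime_cc d1).
  have ng : n - g == 0 by rewrite hn d1 muln1 subnn.
  by apply: lab => x; rewrite hval /final_label ng.
have ng : (n - g == 0) = false by rewrite hn; nia.
have [h hlab hmax] : exists2 h : 'I_n -> nat, (fun x : 'I_n => m (val x)) =1 h &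
    internal e u v h = maxn (internal e u v lS) (internal e u v lM) /\
    forall x, balanced c cc (cluster h x) 1.
  have bS := rank_balanced hr g0 cc0 hN hNc
    (perm_split_order esym eirr eacyc euv hdom uLu uLv ltLu ltLv hLu hLv).
  have bM := rank_balanced hr g0 cc0 hN hNc
    (perm_merge_order esym eirr eacyc euv hdom uLu uLv ltLu ltLv hLu hLv).
  have eS := score (rank_label r N g (val u :: Lu ++ rcons Lv (val v))).
  have eM := score (rank_label r N g (val u :: val v :: Lu ++ Lv)).
  case hsc : (internal e u v lS - internal e u v lM == 0).
    exists lM; first by move=> x; rewrite hval /final_label ng eS eM hsc.
    by split=> //; symmetry; apply/maxn_idPr; rewrite -subn_eq0 hsc.
  exists lS; first by move=> x; rewrite hval /final_label ng eS eM hsc.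
  by split=> //; symmetry; apply/maxn_idPl; move/negbT: hsc; rewrite subn_eq0 -ltnNge => /ltnW.
have [hI hb] := hmax.
apply: (min_cost_of_scores esym eirr eacyc euv hdom hr g0 cc0 hN hNc (erefl d) uLu uLv
  ltLu ltLv hLu hLv coprime_cc d1 (lab _ hlab) hb hI).
Qed.
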